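(* Let $p$ be a prime and let $W$ be a DVR with quotient field $\mathbb{Q}(X)$ such that $W\cap\mathbb{Q}=\mathbb{Z}_{(p)}$. Then: (1) $W=\mathbb{Z}_{(p),\alpha,\delta}$ for some admissible pair $(\alpha,\delta)\in\mathbb{C}_p^{\mathrm{br}}\times(\mathbb{Q}\cup\{\infty\})$; in this case $X\in W$ if and only if $(\alpha,\delta)\in\mathbb{O}_p^{\mathrm{br}}\times(\mathbb{Q}_{\ge0}\cup\{\infty\})$. (2) $W$ is residually transcendental over $\mathbb{Z}_{(p)}$ if and only if $\delta<\infty$, and $W$ is residually algebraic over $\mathbb{Z}_{(p)}$ if and only if $\delta=\infty$ and $\alpha$ is transcendental over $\mathbb{Q}$. Consequently, the set of DVRs of $\mathbb{Q}(X)$ residually algebraic over $\mathbb{Z}_{(p)}$ is $\{\mathbb{Z}_{(p),\alpha,\infty}:\alpha\in\mathbb{C}_p^{\mathrm{br}},\ \alpha\text{ transcendental over }\mathbb{Q}\}$, and the set of DVRs of $\mathbb{Q}(X)$ residually transcendental over $\mathbb{Z}_{(p)}$ is $\{\mathbb{Z}_{(p),\alpha,\delta}:(\alpha,\delta)\in\overline{\mathbb{Q}_p}\times\mathbb{Q}\}$.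
   Context: Fix a prime $p$. $\mathbb{Q}_p$ is the field of $p$-adic numbers, $\overline{\mathbb{Q}_p}$ a fixed algebraic closure, $v_p$ the unique extension of the $p$-adic valuation to $\overline{\mathbb{Q}_p}$, $\mathbb{C}_p$ the completion of $\overline{\mathbb{Q}_p}$ (valuation still $v_p$), $\mathbb{O}_p=\{x\in\mathbb{C}_p:v_p(x)\ge0\}$. $\mathbb{C}_p^{\mathrm{br}}$ is the set of $\alpha\in\mathbb{C}_p$ such that the ramification index of $\mathbb{Q}_p(\alpha)/\mathbb{Q}_p$ (the index of $\mathbb{Z}=v_p(\mathbb{Q}_p^* )$ in $v_p(\mathbb{Q}_p(\alpha)^* )$) is finite, and $\mathbb{O}_p^{\mathrm{br}}=\mathbb{O}_p\cap\mathbb{C}_p^{\mathrm{br}}$. A pair $(\alpha,\delta)\in\mathbb{C}_p\times(\mathbb{Q}\cup\{\infty\})$ is admissible if: when $\delta\in\mathbb{Q}$, $\alpha\in\overline{\mathbb{Q}_p}$; when $\delta=\infty$, $\alpha$ is transcendental over $\mathbb{Q}$. For an admissible pair with $\delta\in\mathbb{Q}$, $v_{p,\alpha,\delta}$ is the monomial valuation on $\mathbb{C}_p(X)$ given on polynomials by $v_{p,\alpha,\delta}(\sum_i a_i(X-\alpha)^i)=\min_i\{v_p(a_i)+i\delta\}$ ($a_i\in\mathbb{C}_p$); for $\delta=\infty$, $v_{p,\alpha,\infty}(\varphi)=v_p(\varphi(\alpha))$ for $\varphi\in\mathbb{Q}(X)$. Set $\mathbb{Z}_{(p),\alpha,\delta}=\{\varphi\in\mathbb{Q}(X):v_{p,\alpha,\delta}(\varphi)\ge0\}$.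 An extension $W$ of $\mathbb{Z}_{(p)}$ to $\mathbb{Q}(X)$ is residually algebraic/transcendental if its residue field is algebraic/transcendental over $\mathbb{Z}/p\mathbb{Z}$. *)

(* Defs.v *)
From HB Require Import structures.
From mathcomp Require Import all_boot all_order all_algebra.
Set Implicit Arguments.
Unset Strict Implicit.
Unset Printing Implicit Defensive.
Import Order.TTheory GRing.Theory Num.Theory.
Local Open Scope ring_scope.

Definition QX := {fraction {poly rat}}.
Definition QXof (f : {poly rat}) : QX := FracField.tofrac f.
Definition QX_X : QX := QXof 'X.
Definition QXconst (q : rat) : QX := QXof q%:P.

(** The p-adic valuation on Q^x (junk value on 0). *)
Definition vp (p : nat) (q : rat) : rat :=
  ((logn p `|numq q|)%:Z - (logn p `|denq q|)%:Z)%:~R.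

Definition inZp (p : nat) (q : rat) : Prop := ~~ (p %| `|denq q|)%N.

(** Abstract model of (C_p, v_p): an algebraically closed field K with a
    Q-valued valuation v (v 0 is an irrelevant junk value) extending the
    p-adic valuation of Q, complete, in which the algebraic closure of Q
    is dense.  These properties characterize (C_p, v_p) up to
    valuation-preserving isomorphism (C_p = completion of Qbar). *)
Section Cp.
Variables (p : nat) (K : closedFieldType) (v : K -> rat).

Definition algebraic_over_Q (x : K) : Prop :=
  exists P : {poly rat}, P != 0 /\ root (map_poly ratr P) x.

Definition transcendental_over_Q (x : K) : Prop := ~ algebraic_over_Q x.

Definition close (n : nat) (x y : K) : Prop := x = y \/ (n%:R <= v (x - y)).

Record Cp_model : Prop := {
  Cp_char0 : [pchar K] =i pred0;
  Cp_mul : forall x y, x != 0 -> y != 0 -> v (x * y) = v x + v y;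
  Cp_add : forall x y, x != 0 -> y != 0 -> x + y != 0 ->
             Order.min (v x) (v y) <= v (x + y);
  Cp_extends : forall q : rat, q != 0 -> v (ratr q) = vp p q;
  Cp_complete : forall u : nat -> K,
      (forall n : nat, exists N, forall m k, (N <= m)%N -> (N <= k)%N -> close n (u m) (u k)) ->
      exists l, forall n : nat, exists N, forall m, (N <= m)%N -> close n (u m) l;
  Cp_dense : forall (x : K) (n : nat), exists y, algebraic_over_Q y /\ close n x y
}.

Definition inQp (x : K) : Prop := forall n : nat, exists q : rat, close n x (ratr q).

Definition polyQp (P : {poly K}) : Prop := forall i, inQp P`_i.

Definition algebraic_over_Qp (x : K) : Prop :=
  exists P : {poly K}, P != 0 /\ polyQp P /\ root P x.

Definition in_Qp_adj (a y : K) : Prop :=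
  exists P Q : {poly K}, polyQp P /\ polyQp Q /\ Q.[a] != 0 /\ y = P.[a] / Q.[a].

Definition valgroup (a : K) (r : rat) : Prop :=
  exists y, in_Qp_adj a y /\ y != 0 /\ v y = r.

(** ramification index [v(Q_p(a)^x) : Z] is finite; since Z <= v(Q_p(a)^x) <= Q,
    this means the value group is contained in (1/N)Z for some N > 0. *)
Definition in_Cpbr (a : K) : Prop :=
  exists N : nat, (0 < N)%N /\ forall r, valgroup a r -> (N%:R * r) \is a Num.int.

Definition in_Op (a : K) : Prop := a = 0 \/ 0 <= v a.

(** delta : option rat, None standing for infinity *)
Definition admissible (a : K) (d : option rat) : Prop :=
  match d with
  | Some _ => algebraic_over_Qp a
  | None => transcendental_over_Q a
  end.

(** monomial valuation of a nonzero q in K[X]: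
    min_i { v(a_i) + i d } where q = sum_i a_i (X - a)^i.  The seed of the
    min is the term of the leading coefficient, itself one of the terms. *)
Definition monov (a : K) (d : rat) (q : {poly K}) : rat :=
  let t := q \Po ('X + a%:P) in
  \big[Order.min/ (v (lead_coef t) + ((size t).-1)%:R * d)]_(i < size t | t`_i != 0)
     (v t`_i + i%:R * d).

(** Z_(p),a,d = { phi in Q(X) : v_{p,a,d}(phi) >= 0 }, with
    v(f/g) = v(f) - v(g) for f, g in Q[X] *)
Definition Zpad (a : K) (d : option rat) (phi : QX) : Prop :=
  match d with
  | Some d => exists f g : {poly rat}, g != 0 /\ phi = QXof f / QXof g /\
       (f = 0 \/ monov a d (map_poly ratr g) <= monov a d (map_poly ratr f))
  | None => exists f g : {poly rat}, (map_poly ratr g).[a] != 0 /\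
       phi = QXof f / QXof g /\
       ((map_poly ratr f).[a] = 0 \/
        v (map_poly ratr g).[a] <= v (map_poly ratr f).[a])
  end.

End Cp.

Definition isDVR (W : QX -> Prop) : Prop :=
  exists w : QX -> int,
    (forall x y, x != 0 -> y != 0 -> w (x * y) = w x + w y) /\
    (forall x y, x != 0 -> y != 0 -> x + y != 0 -> Order.min (w x) (w y) <= w (x + y)) /\
    (exists x, x != 0 /\ w x = 1) /\
    (forall x, W x <-> x = 0 \/ 0 <= w x).

Definition lies_over_Zp (p : nat) (W : QX -> Prop) : Prop :=
  forall q : rat, W (QXconst q) <-> inZp p q.

Definition maxideal (W : QX -> Prop) (x : QX) : Prop := W x /\ (x = 0 \/ ~ W x^-1).

(** Residue field of W algebraic over Z/pZ: every residue class is a root of a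
    nonzero polynomial over F_p, i.e. of the reduction of an integer polynomial
    having a coefficient not divisible by p. *)
Definition res_algebraic (p : nat) (W : QX -> Prop) : Prop :=
  forall t, W t -> exists P : {poly int},
    (exists i, ~~ (p%:Z %| P`_i)%Z) /\ maxideal W (map_poly intr P).[t].

Definition res_transcendental (p : nat) (W : QX -> Prop) : Prop :=
  ~ res_algebraic p W.

(* Main.v *)
From HB Require Import structures.
Require Import Defs.
From mathcomp Require Import all_boot all_order all_algebra.
From mathcomp Require Import boolp classical_sets.
From mathcomp Require Import lra ring.
Set Implicit Arguments.
Unset Strict Implicit.
Unset Printing Implicit Defensive.
Import Order.TTheory GRing.Theory Num.Theory.
Local Open Scope ring_scope.

(* A discrete valuation ring W over Z_(p) gives a valuation u on Q[X] extending v_p, with values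
   in (1/e)Z.  Since K and Q(X) are linearly disjoint over Q, 1/p does not lie in the subring of
   K(X) generated by W and the valuation ring of K; a maximal subring containing this one and not
   1/p is a valuation ring B inducing the given valuations on K and on Q(X).

   If W is residually algebraic, X is a limit of constants for B.  Otherwise, for every degree d,
   the values of the monic polynomials of degree d with coefficients in the closure of Q(X) in K
   are bounded, hence have a maximum, attained at some g_d.  Two of g_0, ..., g_e have the same
   value modulo Z, so that g_j / (p^k g_i) is a unit; its residue lifts to a Teichmueller element
   c of the closure, and g_j - c p^k g_i has a greater value than g_j.  By completeness X is
   infinitely close to some a in K, and W is the ring of the pair (a, oo).

   If W is not residually algebraic, some X - b has the greatest value among all X - b': otherwise
   every f(X) is equivalent to some f(b), whose residue is algebraic.  By density b may be taken
   algebraic over Q, and then u is the monomial valuation of center b and radius the value of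
   X - b.

   Conversely, value groups are discrete because an element of degree n over Q has its valuation
   in (1/n!)Z, and the residue field of a monomial valuation centered at a root b of f contains
   the residue of c f^m, for suitable c and m, which is transcendental. *)

(** * Valuations and Gauss extensions *)

(** [K] and Q(X) carry separate valuations, so the size of X - b for b in [K] has a meaning only
    after both are extended to K(X). The extension may have rank greater than one: when X is
    infinitely close to a, X - a is smaller than every nonzero constant although all values on Q(X)
    are rational. Hence [B] is handled through its divisibility preorder, and a rational value is
    assigned only to elements of the same order as a constant. In the residually algebraic case,
    Q(X) alone is too small: correcting g_j needs a lift to [K] of a residue, and the corrected
    polynomial must still have its value in (1/e)Z. The closure of Q(X) meets both demands. An
    element of it bounded below by a constant has the order and leading residue of an element of
    Q(X), and Teichmueller representatives, being limits of powers of an element x of Q(X), belong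
    to it. *)

Definition is_val (F : idomainType) (v : F -> rat) : Prop :=
  (forall x y, x != 0 -> y != 0 -> v (x * y) = v x + v y) /\
  (forall x y, x != 0 -> y != 0 -> x + y != 0 ->
     Order.min (v x) (v y) <= v (x + y)).

Section Valuation.
Variables (F : idomainType) (v : F -> rat).
Hypothesis hv : is_val v.

Lemma fvalM x y : x != 0 -> y != 0 -> v (x * y) = v x + v y.
Proof. exact: hv.1. Qed.

Lemma fval1 : v 1 = 0.
Proof.
have := fvalM (oner_neq0 F) (oner_neq0 F); rewrite mulr1 => /eqP.
by rewrite -subr_eq subrr => /eqP.
Qed.

Lemma fvalX x n : x != 0 -> v (x ^+ n) = n%:R * v x.
Proof.
move=> x0; elim: n => [|n IH]; first by rewrite expr0 fval1 mul0r.
by rewrite exprS fvalM ?expf_neq0// IH -natr1 mulrDl mul1r addrC.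
Qed.

Lemma fvalN1 : v (- 1) = 0.
Proof.
have n1 : (-1 : F) != 0 by rewrite oppr_eq0 oner_neq0.
by have := fvalM n1 n1; rewrite mulrNN mulr1 fval1; lra.
Qed.

Lemma fvalN x : v (- x) = v x.
Proof.
case: (eqVneq x 0) => [->|x0]; first by rewrite oppr0.
by rewrite -mulN1r fvalM ?oppr_eq0 ?oner_neq0// fvalN1 add0r.
Qed.

Definition vge r x := (x == 0) || (r <= v x).
Definition vgt r x := (x == 0) || (r < v x).

Lemma vge0 r : vge r 0. Proof. by rewrite /vge eqxx. Qed.
Lemma vgt0 r : vgt r 0. Proof. by rewrite /vgt eqxx. Qed.
Lemma vgeN r x : vge r (- x) = vge r x.
Proof. by rewrite /vge oppr_eq0 fvalN. Qed.
Lemma vgtN r x : vgt r (- x) = vgt r x.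
Proof. by rewrite /vgt oppr_eq0 fvalN. Qed.
Lemma vgtW r x : vgt r x -> vge r x.
Proof. by rewrite /vgt /vge; case: eqP => //= _ /ltW. Qed.
Lemma vge_le r s x : s <= r -> vge r x -> vge s x.
Proof. by move=> h; rewrite /vge; case: eqP => //= _; apply: le_trans. Qed.
Lemma vge_gt r s x : s < r -> vge r x -> vgt s x.
Proof. by move=> h; rewrite /vge /vgt; case: eqP => //= _; apply: lt_le_trans. Qed.
Lemma vge_val r x : x != 0 -> vge r x = (r <= v x).
Proof. by rewrite /vge => /negPf ->. Qed.
Lemma vgt_val r x : x != 0 -> vgt r x = (r < v x).
Proof. by rewrite /vgt => /negPf ->. Qed.
Lemma vge_refl x : vge (v x) x.
Proof. by rewrite /vge lexx orbT. Qed.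

Lemma vgeD r x y : vge r x -> vge r y -> vge r (x + y).
Proof.
rewrite /vge; case: (eqVneq x 0) => [->|x0]; first by rewrite add0r.
case: (eqVneq y 0) => [->|y0]; first by rewrite addr0 (negPf x0).
case: (eqVneq (x + y) 0) => //= s0 h1 h2.
by apply: le_trans (hv.2 _ _ x0 y0 s0); rewrite le_min h1.
Qed.

Lemma vgtD r x y : vgt r x -> vgt r y -> vgt r (x + y).
Proof.
rewrite /vgt; case: (eqVneq x 0) => [->|x0]; first by rewrite add0r.
case: (eqVneq y 0) => [->|y0]; first by rewrite addr0 (negPf x0).
case: (eqVneq (x + y) 0) => //= s0 h1 h2.
by apply: lt_le_trans (hv.2 _ _ x0 y0 s0); rewrite lt_min h1.
Qed.

Lemma vgeB r x y : vge r x -> vge r y -> vge r (x - y).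
Proof. by move=> h1 h2; apply: vgeD; rewrite ?vgeN. Qed.

Lemma vgeM r s x y : vge r x -> vge s y -> vge (r + s) (x * y).
Proof.
rewrite /vge mulf_eq0; case: (eqVneq x 0) => //= x0.
by case: (eqVneq y 0) => //= y0 h1 h2; rewrite fvalM// lerD.
Qed.

Lemma vge_gtM r s x y : vge r x -> vgt s y -> vgt (r + s) (x * y).
Proof.
rewrite /vge /vgt mulf_eq0; case: (eqVneq x 0) => //= x0.
by case: (eqVneq y 0) => //= y0 h1 h2; rewrite fvalM// ler_ltD.
Qed.

Lemma vge_sum r (I : Type) (s : seq I) (P : pred I) (G : I -> F) :
  (forall i, P i -> vge r (G i)) -> vge r (\sum_(i <- s | P i) G i).
Proof.
move=> h; elim/big_ind: _ => //; first exact: vge0.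
exact: vgeD.
Qed.

Lemma vgt_sum r (I : Type) (s : seq I) (P : pred I) (G : I -> F) :
  (forall i, P i -> vgt r (G i)) -> vgt r (\sum_(i <- s | P i) G i).
Proof.
move=> h; elim/big_ind: _ => //; first exact: vgt0.
exact: vgtD.
Qed.

Lemma val_perturb x y : x != 0 -> vgt (v x) (y - x) -> y != 0 /\ v y = v x.
Proof.
move=> x0 h.
have y0 : y != 0.
  by apply: contraTneq h => ->; rewrite sub0r vgtN vgt_val// ltxx.
split=> //; apply/eqP; rewrite eq_le; apply/andP; split; last first.
  rewrite -vge_val// -(subrK x y); apply: vgeD; last exact: vge_refl.
  exact: vgtW.
rewrite leNgt; apply/negP => lt.
have := vgtD h (_ : vgt (v x) (- y)); rewrite vgtN vgt_val// => /(_ lt).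
by rewrite addrAC subrr sub0r vgtN vgt_val// ltxx.
Qed.

Lemma val_prod (I : Type) (s : seq I) (G : I -> F) :
  (forall i, G i != 0) -> v (\prod_(i <- s) G i) = \sum_(i <- s) v (G i).
Proof.
move=> h; elim: s => [|i s IH]; first by rewrite !big_nil fval1.
by rewrite !big_cons fvalM ?IH//; elim/big_ind: _ => //; [exact: oner_neq0 | exact: mulf_neq0].
Qed.

Lemma is_val_shift (G : idomainType) (f : {rmorphism G -> F}) :
  injective f -> is_val (v \o f).
Proof.
move=> fi; have f0 x : x != 0 -> f x != 0 by rewrite -(rmorph0 f) (inj_eq fi).
split=> x y x0 y0; first by rewrite /= rmorphM fvalM ?f0.
by move=> /f0; rewrite /= rmorphD; apply: hv.2; rewrite f0.
Qed.

End Valuation.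

Section FieldValuation.
Variables (F : fieldType) (v : F -> rat).
Hypothesis hv : is_val v.

Lemma fvalV x : x != 0 -> v x^-1 = - v x.
Proof.
by move=> x0; have := fvalM hv x0 (invr_neq0 x0); rewrite mulfV// (fval1 hv); lra.
Qed.

Lemma val_div x y : x != 0 -> y != 0 -> v (x / y) = v x - v y.
Proof. by move=> x0 y0; rewrite (fvalM hv) ?invr_neq0// fvalV. Qed.
End FieldValuation.

(** * Gauss valuations of polynomials *)

Section Gauss.
Variables (F : idomainType) (v : F -> rat).
Hypothesis hv : is_val v.
Variable d : rat.

Definition gaussv (t : {poly F}) : rat :=
  \big[Order.min/ (v (lead_coef t) + ((size t).-1)%:R * d)]_(i < size t | t`_i != 0)
     (v t`_i + i%:R * d).

Implicit Types s t : {poly F}.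

Lemma gaussv_le t i : t`_i != 0 -> gaussv t <= v t`_i + i%:R * d.
Proof.
move=> ti; have lt : (i < size t)%N.
  by rewrite ltnNge; apply: contra ti => h; rewrite nth_default.
by rewrite /gaussv (bigD1 (Ordinal lt))//= ge_min lexx.
Qed.

Lemma gaussv_attained t : t != 0 -> exists2 i, t`_i != 0 & v t`_i + i%:R * d = gaussv t.
Proof.
move=> t0; rewrite /gaussv; elim/big_ind: _ => [|x y [i ti <-] [j tj <-]|i ti].
- by exists (size t).-1 => //; rewrite -lead_coefE lead_coef_eq0.
- by rewrite /Order.min; case: ifP => _; [exists i | exists j].
- by exists i.
Qed.

Lemma gaussv_vge t i : vge v (gaussv t - i%:R * d) t`_i.
Proof.
by rewrite /vge; case: eqP => //= /eqP /gaussv_le; rewrite lerBlDr.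
Qed.

Lemma le_gaussv t r : t != 0 -> (forall i, vge v (r - i%:R * d) t`_i) -> r <= gaussv t.
Proof.
by move=> t0 h; have [i ti <-] := gaussv_attained t0; have := h i; rewrite vge_val// lerBlDr.
Qed.

Lemma gaussv_eq t r i : t`_i != 0 -> v t`_i + i%:R * d = r ->
  (forall i, vge v (r - i%:R * d) t`_i) -> gaussv t = r.
Proof.
move=> ti <- h; apply/eqP; rewrite eq_le gaussv_le// le_gaussv//.
by apply: contraNneq ti => ->; rewrite coef0.
Qed.

(** Gauss's lemma is proved without residue fields: the least index at which the minimum is attained
    replaces the lowest nonzero term of the reduction. *)
Lemma gaussv_first t : t != 0 ->
  exists i, [/\ t`_i != 0, v t`_i + i%:R * d = gaussv t &
    forall j, (j < i)%N -> vgt v (gaussv t - j%:R * d) t`_j].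
Proof.
move=> t0; have [i ti E] := gaussv_attained t0.
have ex : exists i, (t`_i != 0) && (v t`_i + i%:R * d == gaussv t).
  by exists i; rewrite ti E eqxx.
case: (ex_minnP ex) => k /andP[tk /eqP Ek] mk; exists k; split=> // j jk.
rewrite /vgt; case: eqVneq => //= tj; rewrite ltrBlDr lt_def gaussv_le// andbT.
by apply/negP => e; have := mk j; rewrite tj e /= leqNgt jk => /(_ isT).
Qed.

Lemma gaussvM s t : s != 0 -> t != 0 -> gaussv (s * t) = gaussv s + gaussv t.
Proof.
move=> s0 t0; have [i [si Ei mi]] := gaussv_first s0.
have [j [tj Ej mj]] := gaussv_first t0.
have term a b : vge v (gaussv s + gaussv t - (a + b)%:R * d) (s`_a * t`_b).
  rewrite natrD mulrDl opprD addrACA.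
  by apply: vgeM => //; apply: gaussv_vge.
have val_ij : v (s`_i * t`_j) = gaussv s + gaussv t - (i + j)%:R * d.
  by rewrite fvalM// -Ei -Ej natrD; ring.
have nz : s`_i * t`_j != 0 by rewrite mulf_neq0.
(* Any other product in this coefficient has its first index below [i] or its second below [j],
   hence a strictly greater value. *)
have [] : (s * t)`_(i + j) != 0 /\ v (s * t)`_(i + j) = v (s`_i * t`_j).
  apply: val_perturb => //.
  rewrite coefM (bigD1 (inord i : 'I_(i + j).+1))//= inordK ?ltnS ?leq_addr//.
  rewrite addKn addrAC subrr add0r; apply: vgt_sum => //= k ki.
  rewrite val_ij.
  have kle : (k <= i + j)%N by rewrite -ltnS.
  rewrite -[in X in X%:R](subnKC kle) natrD mulrDl opprD addrACA.
  have [lt|ge] := ltnP k i.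
    rewrite [_`__ * _]mulrC [X in vgt _ X]addrC; apply: vge_gtM => //; [exact: gaussv_vge|exact: mi].
  apply: vge_gtM => //; first exact: gaussv_vge.
  apply: mj; rewrite ltn_subLR// ltn_add2r ltn_neqAle ge andbT.
  by apply: contra ki => /eqP e; apply/eqP/val_inj; rewrite /= inordK ?ltnS ?leq_addr// e.
move=> n E; apply: (gaussv_eq n); first by rewrite E val_ij subrK.
move=> k; rewrite coefM; apply: vge_sum => //= l _.
have kle : (l <= k)%N by rewrite -ltnS.
by rewrite -[in X in X%:R](subnKC kle).
Qed.

Lemma gaussvD s t : s != 0 -> t != 0 -> s + t != 0 ->
  Order.min (gaussv s) (gaussv t) <= gaussv (s + t).
Proof.
move=> s0 t0 st0; apply: le_gaussv => // i; rewrite coefD; apply: vgeD => //.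
  by apply: vge_le (gaussv_vge s i); rewrite lerD2r ge_min lexx.
by apply: vge_le (gaussv_vge t i); rewrite lerD2r ge_min lexx orbT.
Qed.

Lemma gaussvC c : gaussv c%:P = v c.
Proof.
case: (eqVneq c 0) => [->|c0].
  (* Here both sides are the default [v 0]: the empty minimum returns its seed. *)
  by rewrite /gaussv size_poly0 big_ord0 lead_coef0 mul0r addr0.
apply: (@gaussv_eq _ _ 0%N); rewrite ?coefC//= ?mul0r ?addr0//.
move=> [|i]; rewrite coefC/=; last exact: vge0.
by rewrite mul0r subr0 vge_refl.
Qed.

Lemma gaussv_XaddC c : gaussv ('X + c%:P) = if c == 0 then d else Order.min d (v c).
Proof.
have E i : ('X + c%:P)`_i = if i == 0 then c else if i == 1 then 1 else 0 :> F.
  rewrite coefD coefX coefC; case: i => [|[|i]] //=; rewrite ?add0r ?addr0//.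
have aux r : r <= d -> vge v r c -> forall i, vge v (r - i%:R * d) ('X + c%:P)`_i.
  move=> rd rc [|[|i]]; rewrite E /=; last exact: vge0.
    by rewrite mul0r subr0.
  by rewrite mul1r vge_val ?oner_neq0// (fval1 hv) subr_le0.
case: (eqVneq c 0) => [c0|c0].
  apply: (@gaussv_eq _ _ 1%N).
  - by rewrite E oner_neq0.
  - by rewrite E /= (fval1 hv) add0r mul1r.
  - by apply: aux => //; rewrite c0 vge0.
rewrite /Order.min; case: ifP => [lt|/negbT]; last rewrite -leNgt => ge.
  apply: (@gaussv_eq _ _ 1%N).
  - by rewrite E oner_neq0.
  - by rewrite E /= (fval1 hv) add0r mul1r.
  - by apply: aux => //; rewrite vge_val// ltW.
apply: (@gaussv_eq _ _ 0%N).
- by rewrite E.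
- by rewrite E /= mul0r addr0.
- by apply: aux => //; rewrite vge_refl.
Qed.

End Gauss.

(** * Monomial valuations over an algebraically closed field *)

Section Monov.
Variables (K : closedFieldType) (v : K -> rat).
Hypothesis hv : is_val v.

Lemma comp_XaddC_neq0 (a : K) (q : {poly K}) : q != 0 -> q \Po ('X + a%:P) != 0.
Proof. by rewrite -!size_poly_eq0 size_comp_poly2 ?size_XaddC. Qed.

Lemma monovE a d q : monov v a d q = gaussv v d (q \Po ('X + a%:P)).
Proof. by []. Qed.

Lemma monov_val a d : is_val (monov v a d).
Proof.
split=> x y x0 y0; rewrite !monovE.
  by rewrite comp_polyM gaussvM// comp_XaddC_neq0.
move=> s0; rewrite comp_polyD; apply: gaussvD => //; rewrite ?comp_XaddC_neq0//.
by rewrite -comp_polyD comp_XaddC_neq0.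
Qed.

Lemma monovC a d c : monov v a d c%:P = v c.
Proof. by rewrite monovE comp_polyC gaussvC. Qed.

Definition mindist a d b := if b == a then d else Order.min d (v (a - b)).

Lemma monov_XsubC a d b : monov v a d ('X - b%:P) = mindist a d b.
Proof.
rewrite monovE comp_polyB comp_polyX comp_polyC -addrA -polyCB gaussv_XaddC//.
by rewrite subr_eq0 eq_sym.
Qed.

Lemma factor_poly (f : {poly K}) : f != 0 ->
  exists2 s : seq K, f = lead_coef f *: \prod_(b <- s) ('X - b%:P) & forall b, root f b = (b \in s).
Proof.
move=> f0; have [s E] := closed_field_poly_normal f; exists s => // b.
by rewrite E rootZ ?lead_coef_eq0// root_prod_XsubC.
Qed.

Lemma monov_prod a d c (s : seq K) : c != 0 ->
  monov v a d (c *: \prod_(b <- s) ('X - b%:P)) = v c + \sum_(b <- s) mindist a d b.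
Proof.
move=> c0; rewrite -mul_polyC (fvalM (monov_val a d)) ?polyC_eq0//; last first.
  exact/monic_neq0/monic_prod_XsubC.
rewrite monovC (val_prod (monov_val a d)); last by move=> i; rewrite polyXsubC_eq0.
by congr (_ + _); apply: eq_bigr => b _; rewrite monov_XsubC.
Qed.

Lemma mindist_close a a' d b : vge v d (a - a') -> mindist a d b = mindist a' d b.
Proof.
suff H x y : vge v d (x - y) -> mindist x d b <= mindist y d b.
  by move=> h; apply/eqP; rewrite eq_le !H// -vgeN// opprB.
move=> h.
(* The lower bounds [r] of [mindist z d b] satisfy [r <= d], so moving the center [z] by an element
   of value at least [d] does not affect the second condition. *)
have G z r : (r <= mindist z d b) = (r <= d) && vge v r (z - b).
  rewrite /mindist; case: (eqVneq b z) => [->|bz]; first by rewrite subrr vge0 andbT.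
  by rewrite vge_val ?subr_eq0 1?eq_sym// le_min.
rewrite G; have /andP[le1 le2] : (mindist x d b <= d) && vge v (mindist x d b) (x - b).
  by rewrite -G.
rewrite le1 /= (_ : y - b = (x - b) - (x - y)); last by ring.
by apply: vgeB => //; apply: vge_le h.
Qed.

(** Only the ball of radius [d] around the center matters. Combined with density, this allows every
    center to be replaced by one algebraic over Q. *)
Lemma monov_close a a' d f : vge v d (a - a') -> f != 0 -> monov v a d f = monov v a' d f.
Proof.
move=> h f0; have [s E _] := factor_poly f0.
rewrite E !monov_prod ?lead_coef_eq0//; congr (_ + _).
by apply: eq_bigr => b _; apply: mindist_close.
Qed.

End Monov.

(** * Existence of valuation rings *)

Definition subring (R : comPzRingType) (A : R -> Prop) : Prop :=
  [/\ A 1, forall x y, A x -> A y -> A (x - y) & forall x y, A x -> A y -> A (x * y)].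

Section SubringTheory.
Variables (R : comNzRingType) (A : R -> Prop).
Hypothesis hA : subring A.

Lemma subring1 : A 1. Proof. by case: hA. Qed.
Lemma subringB x y : A x -> A y -> A (x - y). Proof. by case: hA => _ + _; apply. Qed.
Lemma subringM x y : A x -> A y -> A (x * y). Proof. by case: hA => _ _; apply. Qed.
Lemma subring0 : A 0. Proof. by rewrite -(subrr 1); apply: subringB; apply: subring1. Qed.
Lemma subringN x : A x -> A (- x).
Proof. by rewrite -sub0r; apply: subringB; apply: subring0. Qed.
Lemma subringD x y : A x -> A y -> A (x + y).
Proof. by move=> ax ay; rewrite -[y]opprK; apply/subringB/subringN. Qed.
Lemma subring_sum (I : Type) (s : seq I) (P : pred I) (G : I -> R) :
  (forall i, P i -> A (G i)) -> A (\sum_(i <- s | P i) G i).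
Proof.
by move=> h; elim/big_ind: _ => //; [exact: subring0 | exact: subringD].
Qed.
Lemma subringX x n : A x -> A (x ^+ n).
Proof.
by move=> ax; elim: n => [|n IH]; [exact: subring1 | rewrite exprS; exact: subringM].
Qed.

Definition coefs_in (P : {poly R}) := forall i, A P`_i.

Lemma coefs_inD P Q : coefs_in P -> coefs_in Q -> coefs_in (P + Q).
Proof. by move=> hP hQ i; rewrite coefD; apply: subringD. Qed.
Lemma coefs_inB P Q : coefs_in P -> coefs_in Q -> coefs_in (P - Q).
Proof. by move=> hP hQ i; rewrite coefB; apply: subringB. Qed.
Lemma coefs_inM P Q : coefs_in P -> coefs_in Q -> coefs_in (P * Q).
Proof. by move=> hP hQ i; rewrite coefM; apply: subring_sum => j _; apply: subringM. Qed.
Lemma coefs_inZ c P : A c -> coefs_in P -> coefs_in (c *: P).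
Proof. by move=> hc hP i; rewrite coefZ; apply: subringM. Qed.
Lemma coefs_inC c : A c -> coefs_in c%:P.
Proof. by move=> hc i; rewrite coefC; case: ifP => _ //; apply: subring0. Qed.
Lemma coefs_inX : coefs_in 'X.
Proof. by move=> i; rewrite coefX; case: eqP => _; [apply: subring1 | apply: subring0]. Qed.

Definition adjoin x y := exists2 P, coefs_in P & y = P.[x].

Lemma adjoin_subring x : subring (adjoin x).
Proof.
split=> [|_ _ [P hP ->] [Q hQ ->]|_ _ [P hP ->] [Q hQ ->]].
- by exists 1; rewrite ?hornerC//; apply/coefs_inC/subring1.
- by exists (P - Q); rewrite ?hornerE//; apply: coefs_inB.
- by exists (P * Q); rewrite ?hornerE//; apply: coefs_inM.
Qed.

Lemma adjoin_sub x y : A y -> adjoin x y.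
Proof. by move=> ay; exists y%:P; rewrite ?hornerC//; apply: coefs_inC. Qed.

Lemma adjoin_gen x : adjoin x x.
Proof. by exists 'X; rewrite ?hornerX//; apply: coefs_inX. Qed.

Lemma horner_in P x : coefs_in P -> A x -> A P.[x].
Proof.
by move=> hP ax; rewrite horner_coef; apply: subring_sum => i _; apply/subringM/subringX.
Qed.
End SubringTheory.

Definition is_valring (M : fieldType) (B : M -> Prop) : Prop :=
  subring B /\ forall x, B x \/ B x^-1.

Section Chevalley.
Variables (M : fieldType) (w : M).

Section Step.
Variable B : M -> Prop.
Hypotheses (hB : subring B) (Bw : B w) (nw : ~ B w^-1).

Let w0 : w != 0.
Proof. by apply: contra_notN nw => /eqP ->; rewrite invr0; apply: subring0. Qed.

(** This certifies that [w^-1] lies in B[x]; the degree bound [n] is what the descent below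
    decreases. *)
Let T x n := exists P : {poly M}, [/\ coefs_in B P, (size P <= n.+1)%N & w * P.[x] = 1].

Let T0 x : ~ T x 0.
Proof.
move=> [P [hP sP]]; rewrite (size1_polyC sP) hornerC => E; apply: nw.
by rewrite -[w^-1]mulr1 -E mulKf.
Qed.

(* The relation for x^-1, multiplied by x^n, rewrites the leading term of the relation for x. *)
Let Tstep x n m : x != 0 -> (m <= n.+1)%N -> T x n.+1 -> T x^-1 m -> T x n.
Proof.
move=> x0 mn [P [hP sP EP]] [Q [hQ sQ EQ]].
pose R := \poly_(j < n.+1) Q`_(n.+1 - j).
have ER : w * R.[x] = x ^+ n.+1 * (1 - w * Q`_0).
  have EQ' : x ^+ n.+1 * Q.[x^-1] = R.[x] + Q`_0 * x ^+ n.+1.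
    rewrite (horner_coef_wide _ (leq_trans sQ _ : size Q <= n.+2)%N)//.
    rewrite (reindex_inj rev_ord_inj)/= big_ord_recr/= subnn mulrDr expr0 mulr1 mulrC.
    rewrite [_ * Q`_0]mulrC mulrC; congr (_ + _).
    rewrite horner_poly big_distrr /=; apply: eq_bigr => i _.
    rewrite subSS mulrCA; congr (_ * _).
    have le : (i <= n.+1)%N by apply: ltnW; rewrite ltnS -ltnS.
    by rewrite -{1}(subnK le) exprD exprVn mulrAC mulfV ?expf_neq0// mul1r.
  have -> : R.[x] = x ^+ n.+1 * Q.[x^-1] - Q`_0 * x ^+ n.+1 by rewrite EQ' addrK.
  by rewrite mulrBr mulrCA EQ; ring.
(* Obtained by multiplying the relation for [x] by [1 - w * Q_0] and replacing (1 - w Q_0) x^(n+1)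
   by w R(x). Multiplying, rather than dividing, avoids having to show that 1 - w Q_0 is a unit. *)
exists ((Q`_0)%:P + (1 - w * Q`_0) *: take_poly n.+1 P + (w * P`_n.+1) *: R); split.
- do ![apply: coefs_inD => //].
  + exact: coefs_inC.
  + apply: coefs_inZ => //; first by apply: subringB => //; [exact: subring1|exact: subringM].
    by move=> i; rewrite coef_take_poly; case: ifP => _ //; apply: subring0.
  + apply: coefs_inZ => //; first exact: subringM.
    by move=> i; rewrite coef_poly; case: ifP => _ //; apply: subring0.
- apply: (leq_trans (size_polyD _ _)); rewrite geq_max; apply/andP; split.
    apply: (leq_trans (size_polyD _ _)); rewrite geq_max size_polyC.
    by rewrite (leq_trans (size_scale_leq _ _)) ?size_take_poly// (leq_trans (leq_b1 _)).
  by apply: (leq_trans (size_scale_leq _ _)); apply: size_poly.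
have EP' : P.[x] = (take_poly n.+1 P).[x] + P`_n.+1 * x ^+ n.+1.
  rewrite (horner_coef_wide _ sP) big_ord_recr /=; congr (_ + _).
  rewrite (horner_coef_wide _ (size_take_poly _ _)); apply: eq_bigr => i _.
  by rewrite coef_take_poly ltn_ord.
rewrite !hornerE /= !mulrDr [w * (w * _ * _)]mulrCA ER.
have -> : w * ((1 - w * Q`_0) * (take_poly n.+1 P).[x]) =
  (1 - w * Q`_0) * (1 - w * P`_n.+1 * x ^+ n.+1) by rewrite -EP EP'; ring.
ring.
Qed.

(** Descent on the sum of the degrees: [Tstep] lowers the larger one, and exchanging [x] with [x^-1]
    makes it the first. *)
Let Tcontra x : x != 0 -> forall N n m, (n + m <= N)%N -> T x n -> T x^-1 m -> False.
Proof.
move=> x0 N; elim: N x x0 => [|N IH] x x0 n m.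
  by rewrite leqn0 addn_eq0 => /andP[/eqP -> _] /T0.
wlog mn : x x0 n m / (m <= n)%N.
  move=> H; have [|/ltnW nm] := leqP m n; first exact: H.
  rewrite addnC => h tx ty; apply: (H x^-1) nm h ty _; first by rewrite invr_eq0.
  by rewrite invrK.
case: n mn => [|n] mn h tx ty; first exact: T0 tx.
by apply: (IH x x0 n m) => //; apply: Tstep mn tx ty.
Qed.

(** If neither [x] nor [x^-1] is in [B], maximality puts [w^-1] in both B[x] and B[x^-1], which the
    descent excludes. *)
Lemma valring_of_maximal :
  (forall C, subring C -> (forall x, B x -> C x) -> ~ C w^-1 -> forall x, C x -> B x) ->
  is_valring B.
Proof.
move=> maxB; split=> // x; have [Bx|nBx] := pselect (B x); first by left.
have [Bx'|nBx'] := pselect (B x^-1); first by right.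
have x0 : x != 0 by apply: contra_notN nBx => /eqP ->; apply: subring0.
exfalso.
have TT y : ~ B y -> exists n, T y n.
  move=> nBy; have [|nC] := pselect (adjoin B y w^-1).
    by move=> [P hP E]; exists (size P), P; split=> //; rewrite -E mulfV.
  by case: nBy; apply: maxB nC _ (adjoin_gen hB y); [exact: adjoin_subring | exact: adjoin_sub].
have [n tx] := TT _ nBx; have [m ty] := TT _ nBx'.
exact: Tcontra x0 _ _ _ (leqnn _) tx ty.
Qed.
End Step.

Local Open Scope classical_set_scope.

Lemma exists_valring (A : M -> Prop) : subring A -> A w -> ~ A w^-1 ->
  exists B : M -> Prop, [/\ forall x, A x -> B x, is_valring B & ~ B w^-1].
Proof.
move=> hA Aw nA.
(* Adding [A] inside the predicate makes the empty set good, as the union of the empty chain must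
   be. *)
pose good (X : set M) := subring (fun x => A x \/ X x) /\ ~ (A w^-1 \/ X w^-1).
have chain (F : set (set M)) : F `<=` good -> total_on F subset -> good (\bigcup_(X in F) X).
  move=> Fg Ft; pose U x := A x \/ (\bigcup_(X in F) X) x.
  have two x y : U x -> U y -> (A x /\ A y) \/
      exists X, [/\ F X, A x \/ X x & A y \/ X y].
    case=> [ax|[X FX Xx]] [ay|[Y FY Yy]]; first by left.
    - by right; exists Y; split; auto.
    - by right; exists X; split; auto.
    - right; have [XY|YX] := Ft _ _ FX FY.
        by exists Y; split=> //; right => //; apply: XY.
      by exists X; split=> //; right => //; apply: YX.
  have inU X x : F X -> A x \/ X x -> U x.
    by move=> FX [ax|Xx]; [left|right; exists X].
  split; last by case=> [//|[X FX Xw]]; apply: (Fg X FX).2; right.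
  split; first by left; apply: subring1.
    move=> x y /two h /h [[ax ay]|[X [FX hx hy]]]; first by left; apply: subringB.
    apply: (inU X) => //; exact: (subringB (Fg X FX).1 hx hy).
  move=> x y /two h /h [[ax ay]|[X [FX hx hy]]]; first by left; apply: subringM.
  apply: (inU X) => //; exact: (subringM (Fg X FX).1 hx hy).
have [X [[sX nX] maxX]] := Zorn_bigcup chain.
exists (fun x => A x \/ X x); split=> //; first by move=> x; left.
apply: valring_of_maximal => //; first by left.
move=> C sC XC nC x Cx; right; apply: contrapT => nXx; apply: (maxX C).
  split; first by move=> y Xy; apply: XC; right.
  by move=> /(_ _ Cx).
have E : (fun x => A x \/ C x) = C.
  by apply: funext => y; apply: propext; split=> [[ay|]//|]; [apply: XC; left | right].
by split; [rewrite E | case=> // /(fun h => XC _ (or_introl h))].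
Qed.

End Chevalley.

(** * Divisibility preorder of a valuation ring *)

Section Divisibility.
Variables (M : fieldType) (B : M -> Prop).
Hypothesis hB : is_valring B.
Let sB : subring B := hB.1.

(* [dle x y] means |x| <= |y| for the absolute value with valuation ring [B]. *)
Definition dle x y := exists2 b, B b & x = b * y.
Definition dlt x y := ~ dle y x.

Lemma dle_refl x : dle x x.
Proof. by exists 1; rewrite ?mul1r//; apply: subring1. Qed.
Lemma dle_trans y x z : dle x y -> dle y z -> dle x z.
Proof.
move=> [b hb ->] [c hc ->]; exists (b * c); last by rewrite mulrA.
exact: subringM.
Qed.
Lemma dle0 x : dle 0 x.
Proof. by exists 0; rewrite ?mul0r//; apply: subring0. Qed.
Lemma dle_le0 x : dle x 0 -> x = 0.
Proof. by case=> b _ ->; rewrite mulr0. Qed.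
Lemma dle_div x y : y != 0 -> dle x y <-> B (x / y).
Proof.
move=> y0; split=> [[b hb ->]|h]; first by rewrite mulfK.
by exists (x / y); rewrite ?divfK.
Qed.
Lemma dle1 x : dle x 1 <-> B x.
Proof. by rewrite dle_div ?oner_neq0// divr1. Qed.
Lemma dle_total x y : dle x y \/ dle y x.
Proof.
case: (eqVneq y 0) => [->|y0]; first by right; exact: dle0.
case: (eqVneq x 0) => [->|x0]; first by left; exact: dle0.
by case: (hB.2 (x / y)); [left|right]; apply/dle_div; rewrite // -invf_div.
Qed.
Lemma dltW x y : dlt x y -> dle x y.
Proof. by case: (dle_total x y). Qed.
Lemma dle_or_lt x y : dle x y \/ dlt y x.
Proof. by have [h|h] := pselect (dle x y); [left|right]. Qed.
Lemma dle_lt_trans y x z : dle x y -> dlt y z -> dlt x z.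
Proof. by move=> xy yz zx; apply/yz/(dle_trans zx xy). Qed.
Lemma dlt_le_trans y x z : dlt x y -> dle y z -> dlt x z.
Proof. by move=> xy yz zx; apply/xy/(dle_trans yz zx). Qed.
Lemma dlt_neq0 x y : dlt x y -> y != 0.
Proof. by move=> h; apply: contra_notN h => /eqP ->; exact: dle0. Qed.
Lemma dle_neq0 x y : dle x y -> x != 0 -> y != 0.
Proof. by move=> [b _ ->]; apply: contraNneq => ->; rewrite mulr0. Qed.
Lemma dlt0 x : x != 0 -> dlt 0 x.
Proof. by move=> x0 /dle_le0 e; rewrite e eqxx in x0. Qed.

Lemma dleM x y z t : dle x y -> dle z t -> dle (x * z) (y * t).
Proof. by move=> [b hb ->] [c hc ->]; exists (b * c); [exact: subringM | ring]. Qed.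
Lemma dle_mul2r z x y : z != 0 -> dle (x * z) (y * z) <-> dle x y.
Proof.
move=> z0; split=> [[b hb E]|h]; last exact/dleM/dle_refl.
by exists b => //; apply: (mulIf z0); rewrite E mulrA.
Qed.
Lemma dltM x y z t : dlt x y -> dle z t -> t != 0 -> dlt (x * z) (y * t).
Proof.
move=> xy zt t0 h; apply/xy/(dle_mul2r _ _ t0)/(dle_trans h).
exact/dleM/zt/dle_refl.
Qed.
Lemma dleD x y z : dle x z -> dle y z -> dle (x + y) z.
Proof. by move=> [b hb ->] [c hc ->]; exists (b + c); rewrite ?mulrDl//; apply: subringD. Qed.
Lemma dleN x y : dle x y -> dle (- x) y.
Proof. by move=> [b hb ->]; exists (- b); rewrite ?mulNr//; apply: subringN. Qed.
Lemma dleB x y z : dle x z -> dle y z -> dle (x - y) z.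
Proof. by move=> h1 h2; apply/dleD/dleN. Qed.
Lemma dle_sub x y z : dle (x - y) z -> dle (y - x) z.
Proof. by move=> /dleN; rewrite opprB. Qed.
Lemma dltN x y : dlt x y -> dlt (- x) y.
Proof. by move=> h k; apply/h/(dle_trans k)/dleN/dle_refl. Qed.
Lemma dlt_sub x y z : dlt (x - y) z -> dlt (y - x) z.
Proof. by move=> /dltN; rewrite opprB. Qed.
Lemma dltD x y z : dlt x z -> dlt y z -> dlt (x + y) z.
Proof.
move=> h1 h2; have [h|h] := dle_total x y.
  by apply: dle_lt_trans h2; apply: dleD => //; exact: dle_refl.
by apply: dle_lt_trans h1; apply: dleD => //; exact: dle_refl.
Qed.

Lemma dleX x y n : dle x y -> dle (x ^+ n) (y ^+ n).
Proof.
move=> h; elim: n => [|n IH]; first by rewrite !expr0; exact: dle_refl.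
by rewrite !exprS; apply: dleM.
Qed.
Lemma dltX x y n : (0 < n)%N -> dlt x y -> dlt (x ^+ n) (y ^+ n).
Proof.
case: n => // n _ h; rewrite !exprS; apply: dltM => //; first exact/dleX/dltW.
exact/expf_neq0/(dlt_neq0 h).
Qed.
Lemma dleX_inv x y n : (0 < n)%N -> dle (x ^+ n) (y ^+ n) -> dle x y.
Proof. by move=> n0 h; have [//|/(dltX n0)] := dle_or_lt x y. Qed.
Lemma dltX_inv x y n : dlt (x ^+ n) (y ^+ n) -> dlt x y.
Proof. by move=> h k; apply/h/dleX. Qed.

Definition deq x y := dle x y /\ dle y x.
Lemma deq_refl x : deq x x. Proof. by split; exact: dle_refl. Qed.
Lemma deq_sym x y : deq x y -> deq y x. Proof. by case. Qed.
Lemma deq_trans y x z : deq x y -> deq y z -> deq x z.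
Proof. by move=> [h1 h2] [h3 h4]; split; [exact: dle_trans h3 | exact: dle_trans h2]. Qed.
Lemma deqM x y z t : deq x y -> deq z t -> deq (x * z) (y * t).
Proof. by move=> [h1 h2] [h3 h4]; split; apply: dleM. Qed.
Lemma deqX_inv x y n : (0 < n)%N -> deq (x ^+ n) (y ^+ n) -> deq x y.
Proof. by move=> n0 [h1 h2]; split; apply: dleX_inv n0 _. Qed.
Lemma deq_neq0 x y : deq x y -> x != 0 -> y != 0.
Proof. by case=> h _; exact: dle_neq0 h. Qed.

Lemma deqV x y : x != 0 -> y != 0 -> deq x y -> deq x^-1 y^-1.
Proof.
suff H z t : z != 0 -> t != 0 -> dle z t -> dle t^-1 z^-1 by move=> x0 y0 []; split; apply: H.
move=> z0 t0 h; apply/(dle_mul2r _ _ (mulf_neq0 z0 t0)).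
by rewrite mulrCA mulVf// mulr1 mulrA mulVf// mul1r.
Qed.

Lemma deq_perturb x y : dlt (x - y) x -> deq x y.
Proof.
move=> h.
have yx : dle y x.
  rewrite -[y](subKr x); apply: dleB; [exact: dle_refl | exact: dltW].
split=> //; have [//|h'] := dle_or_lt x y.
by case: (dltD h h'); rewrite subrK; exact: dle_refl.
Qed.

(** It says that [x] is nonzero and that [y / x] is a unit of residue 1. This congruence is
    multiplicative, so a product may be estimated factor by factor. *)
Definition near x y := dlt (x - y) x.

Lemma near_refl x : x != 0 -> near x x.
Proof. by move=> x0; rewrite /near subrr; exact: dlt0. Qed.
Lemma near_sym x y : near x y -> near y x.
Proof.
by move=> h; have [h1 _] := deq_perturb h; apply: dlt_le_trans h1; exact: dlt_sub.
Qed.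
Lemma nearM x y z t : near x y -> near z t -> near (x * z) (y * t).
Proof.
move=> h1 h2; have [xy yx] := deq_perturb h1.
rewrite /near (_ : x * z - y * t = (x - y) * z + (z - t) * y); last by ring.
apply: dltD; first by apply: dltM h1 (dle_refl _) (dlt_neq0 h2).
rewrite [x * z]mulrC; apply: dltM h2 yx (dlt_neq0 h1).
Qed.
Lemma near_neq0 x y : near x y -> x != 0. Proof. exact: dlt_neq0. Qed.
Lemma near_deq x y : near x y -> deq x y. Proof. exact: deq_perturb. Qed.
Lemma nearV x y : near x y -> near x^-1 y^-1.
Proof.
move=> h; have x0 := near_neq0 h; have y0 := near_neq0 (near_sym h).
rewrite /near (_ : x^-1 - y^-1 = (y - x) * (x^-1 * y^-1)); last by field; rewrite x0 y0.
rewrite [X in dlt _ X](_ : _ = y * (x^-1 * y^-1)); last by field; rewrite x0 y0.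
apply: dltM (dle_refl _) _; last by rewrite mulf_neq0 ?invr_eq0.
exact: near_sym.
Qed.

End Divisibility.

(** * Extending valuations of Q(X) and K to K(X) *)

Lemma vp_prime p : prime p -> vp p p%:R = 1.
Proof.
move=> pp; rewrite /vp -[p%:R]/(p%:Z%:~R) numq_int denq_int /=.
by rewrite logn_prime// eqxx logn1 subr0.
Qed.

Lemma fracB (F : fieldType) (a b c d : F) : b != 0 -> d != 0 ->
  a / b - c / d = (a * d - c * b) / (b * d).
Proof. by move=> b0 d0; field; rewrite b0 d0. Qed.

(** Used with c = p: if a/b has negative value, the first factor has nonnegative value for large
    [n], so a ring containing it and a/b contains 1/p. *)
Lemma frac_cancel (F : fieldType) (a b c : F) n : a != 0 -> b != 0 -> c != 0 ->
  c^-1 = (b ^+ n / (c * a ^+ n)) * (a / b) ^+ n.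
Proof.
move=> a0 b0 c0; rewrite expr_div_n; have := expf_neq0 n a0; have := expf_neq0 n b0.
by move: (a ^+ n) (b ^+ n) => x y x0 y0; field; rewrite x0 y0 c0.
Qed.

Section CommonExtension.
Variables (p : nat) (K : closedFieldType) (v : K -> rat) (iota : {rmorphism rat -> K}).
Hypotheses (pp : prime p) (hv : is_val v).
Hypothesis vi : forall q, q != 0 -> v (iota q) = vp p q.
Variable u : {poly rat} -> rat.
Hypotheses (hu : is_val u) (uC : forall q, q != 0 -> u q%:P = vp p q).

Local Notation iP := (map_poly iota).
Local Notation M := {fraction {poly K}}.
Local Notation "h %:F" := (FracField.tofrac h).

Lemma rat_prime_neq0 : (p%:R : rat) != 0.
Proof. by rewrite pnatr_eq0 -lt0n prime_gt0. Qed.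
Lemma prime_neq0 : (p%:R : K) != 0.
Proof. by rewrite -(rmorph_nat iota) fmorph_eq0 rat_prime_neq0. Qed.
Lemma val_p : v p%:R = 1.
Proof. by rewrite -(rmorph_nat iota) vi ?rat_prime_neq0// vp_prime. Qed.

(** These are the numerators over a common denominator: the fractions H / g, with [H] in the span of
    level [u g], form the subring generated by the valuation rings of [v] and [u]. *)
Definition integral_span (r : rat) (H : {poly K}) : Prop :=
  exists s : seq (K * {poly rat}),
    (forall x, x \in s -> vge v 0 x.1 /\ vge u r x.2) /\
    H = \sum_(x <- s) x.1 *: iP x.2.

Lemma span_incl r a f : vge v 0 a -> vge u r f -> integral_span r (a *: iP f).
Proof.
move=> ha hf; exists [:: (a, f)]; rewrite big_seq1; split=> // x.
by rewrite inE => /eqP ->.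
Qed.

Lemma spanD r G H : integral_span r G -> integral_span r H -> integral_span r (G + H).
Proof.
move=> [s [hs ->]] [t [ht ->]]; exists (s ++ t); rewrite big_cat; split=> // x.
by rewrite mem_cat => /orP[/hs|/ht].
Qed.

Lemma span0 r : integral_span r 0.
Proof. by exists [::]; rewrite big_nil. Qed.

Lemma span_sum r (s : seq (K * {poly rat})) (G : K * {poly rat} -> {poly K}) :
  (forall x, x \in s -> integral_span r (G x)) -> integral_span r (\sum_(x <- s) G x).
Proof.
move=> h; rewrite big_seq; elim/big_ind: _ => //; [exact: span0 | exact: spanD].
Qed.

Lemma spanM r r' G H : integral_span r G -> integral_span r' H -> integral_span (r + r') (G * H).
Proof.
move=> [s [hs ->]] [t [ht ->]]; rewrite big_distrl /=; apply: span_sum => x /hs[x1 x2].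
rewrite big_distrr /=; apply: span_sum => y /ht[y1 y2].
rewrite -scalerAl -scalerAr scalerA -(rmorphM iP) /=; apply: span_incl; last exact: vgeM.
rewrite -[0]addr0; exact: vgeM.
Qed.

Lemma span_poly f r : vge u r f -> integral_span r (iP f).
Proof.
by move=> h; rewrite -[iP f]scale1r; apply: span_incl => //; rewrite /vge (fval1 hv) lexx orbT.
Qed.

Lemma spanN r H : integral_span r H -> integral_span r (- H).
Proof.
move=> h; have -> : - H = iP (- 1) * H by rewrite rmorphN rmorph1 mulN1r.
rewrite -[r]add0r; apply: spanM => //; apply: span_poly.
by rewrite vgeN// /vge (fval1 hu) lexx orbT.
Qed.

(* Among the relations, one of least length has linearly independent polynomials, and by
   linear disjointness of K and Q(X) it then has rational coefficients. *)
Lemma span_saturated n (a : 'I_n -> K) (f : 'I_n -> {poly rat}) g : g != 0 ->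
  (forall i, vge v 0 (a i)) -> (forall i, vge u (u g) (f i)) ->
  p%:R *: (\sum_i a i *: iP (f i)) != iP g.
Proof.
elim: n a f => [|n IH] a f g0 ha hf.
  by rewrite big_ord0 scaler0 eq_sym map_poly_eq0.
apply/eqP => E.
pose N := (size g + \max_(i < n.+1) size (f i))%N.
have fN i : (size (f i) <= N)%N.
  exact: leq_trans (leq_bigmax (F := fun i => size (f i)) i) (leq_addl _ _).
pose A : 'M[rat]_(n.+1, N) := \matrix_(i, j) (f i)`_j.
have rowsum (R : 'rV[rat]_n.+1) : rVpoly (R *m A) = \sum_i R 0 i *: f i.
  apply/polyP => j; rewrite coef_rVpoly coef_sum.
  case: insubP => [j' _ Ej|nj].
    rewrite !mxE; apply: eq_bigr => i _; by rewrite mxE coefZ Ej.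
  rewrite big1// => i _; rewrite coefZ nth_default ?mulr0//.
  by rewrite (leq_trans (fN i))// leqNgt.
have [free|nfree] := boolP (row_free A).
  have Erow : (\row_i (a i * p%:R)) *m map_mx iota A = map_mx iota (poly_rV g : 'rV_N).
    apply/rowP => j; rewrite !mxE.
    have := congr1 (fun h : {poly K} => h`_j) E; rewrite coefZ coef_sum coef_map => <-.
    by rewrite big_distrr /=; apply: eq_bigr => i _; rewrite !mxE coefZ coef_map; ring.
  have : (map_mx iota (poly_rV g : 'rV_N) <= map_mx iota A)%MS by rewrite -Erow submxMl.
  (* Linear disjointness enters here: a linear system with rational entries that is solvable over
     [K] is solvable over Q, and freeness identifies the two solutions. *)
  rewrite map_submx => /submxP[c Ec].
  have Eac : \row_i (a i * p%:R) = map_mx iota c.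
    by apply: (row_free_inj (A := map_mx iota A)); rewrite ?row_free_map// -map_mxM -Ec.
  have Eg : g = \sum_i c 0 i *: f i.
    by rewrite -rowsum -Ec poly_rV_K// leq_addr.
  (* The rational coefficients are the p a_i, hence of positive value, which would make the value of
     [g] exceed itself. *)
  have : vgt u (u g) g.
    rewrite {2}Eg; apply: vgt_sum => // i _; rewrite -mul_polyC -[u g]add0r addrC mulrC.
    apply: vge_gtM => //; case: (eqVneq (c 0 i) 0) => [->|c0]; first by rewrite polyC0 vgt0.
    rewrite vgt_val ?polyC_eq0// uC// -vi//.
    have /rowP/(_ i) := Eac; rewrite !mxE => <-.
    have ai0 : a i != 0.
      apply: contraNneq c0 => ai; have /rowP/(_ i) := Eac; rewrite !mxE ai mul0r.
      by move/esym/eqP; rewrite fmorph_eq0.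
    rewrite fvalM ?prime_neq0// val_p; have := ha i; rewrite vge_val// => h.
    by apply: ltr_wpDl.
  by rewrite vgt_val// ltxx.
have [c c0 Ec] : exists2 c : 'rV[rat]_n.+1, c != 0 & c *m A = 0.
  have : kermx A != 0 by rewrite kermx_eq0.
  by case/rowV0Pn => c /sub_kermxP Ec c0; exists c.
have Ec' : \sum_i c 0 i *: f i = 0 by rewrite -rowsum Ec linear0.
have [k0 ck0] : exists k, c 0 k != 0.
  apply/existsP; apply: contra_neqT c0 => /existsPn h; apply/rowP => k.
  by rewrite mxE; apply/eqP; have := h k; rewrite negbK.
(* The coefficient of least value is chosen, so that the quotients [q i] are integral and
   eliminating [f k] leaves integral coefficients. *)
pose k := [arg min_(k < k0 | c 0 k != 0) vp p (c 0 k)]%O.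
have [ck mk] : c 0 k != 0 /\ forall i, c 0 i != 0 -> vp p (c 0 k) <= vp p (c 0 i).
  by rewrite /k; case: arg_minP.
pose q i := c 0 i / c 0 k.
have vq i : vge v 0 (iota (q i)).
  rewrite /q /vge fmorph_eq0; case: eqVneq => //= qi0.
  have ci0 : c 0 i != 0 by apply: contraNneq qi0 => ->; rewrite mul0r.
  by rewrite fmorph_div val_div ?fmorph_eq0// !vi// subr_ge0 mk.
have Efk : iP (f k) = - \sum_(i < n) iota (q (lift k i)) *: iP (f (lift k i)).
  have : \sum_i q i *: f i = 0.
    rewrite (eq_bigr (fun i => (c 0 k)^-1 *: (c 0 i *: f i))) ?(-scaler_sumr)//.
      by rewrite -scaler_sumr Ec' scaler0.
    by move=> i _; rewrite scalerA mulrC.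
  rewrite (bigD1_ord k)//= {1}/q mulfV// scale1r => /eqP; rewrite addr_eq0 => /eqP ->.
  rewrite rmorphN rmorph_sum; congr (- _); apply: eq_bigr => i _; exact: map_polyZ.
have /eqP[] : p%:R *: (\sum_i (a (lift k i) - a k * iota (q (lift k i))) *: iP (f (lift k i))) != iP g.
  apply: (IH (fun i => a (lift k i) - a k * iota (q (lift k i)))) => // i.
  by apply: vgeB => //; rewrite -[0]addr0; exact: vgeM.
rewrite -E; congr (_ *: _).
rewrite [RHS](bigD1_ord k)//= Efk scalerN scaler_sumr addrC -sumrB.
by apply: eq_bigr => i _; rewrite scalerBl scalerA.
Qed.

(** That [B] contains both rings is the construction; that it induces nothing larger comes from the
    Archimedean values of [v] and [u]: an element of negative value has a power that, times an
    element of nonnegative value, is 1/p. *)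
Lemma common_extension : exists B : M -> Prop,
  [/\ is_valring B,
    forall c : K, B (c%:P)%:F <-> vge v 0 c &
    forall f g, f != 0 -> g != 0 -> B ((iP f)%:F / (iP g)%:F) <-> u g <= u f].
Proof.
pose A (x : M) := exists H g, [/\ g != 0, integral_span (u g) H & x = H%:F / (iP g)%:F].
have iP0 f : f != 0 -> ((iP f)%:F : M) != 0 by rewrite tofrac_eq0 map_poly_eq0.
have span_refl f : integral_span (u f) (iP f) by apply/span_poly/vge_refl.
have sA : subring A.
  split.
  - exists 1, 1; split; rewrite ?oner_neq0//; last by rewrite !rmorph1 divr1.
    by rewrite -(rmorph1 iP); exact: span_refl.
  - move=> _ _ [H [g [g0 hH ->]]] [H' [g' [g'0 hH' ->]]].
    exists (H * iP g' - H' * iP g), (g * g'); split; rewrite ?mulf_neq0//.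
      rewrite fvalM//; apply: spanD; first exact: spanM.
      by apply: spanN; rewrite addrC; apply: spanM.
    by rewrite (rmorphM iP) tofracB !tofracM fracB ?iP0.
  - move=> _ _ [H [g [g0 hH ->]]] [H' [g' [g'0 hH' ->]]].
    exists (H * H'), (g * g'); split; rewrite ?mulf_neq0//.
      by rewrite fvalM//; apply: spanM.
    by rewrite (rmorphM iP) !tofracM mulf_div.
have AK c : vge v 0 c -> A (c%:P)%:F.
  move=> hc; exists (c%:P), 1; split; rewrite ?oner_neq0//.
    rewrite -[c%:P]alg_polyC -(rmorph1 iP); apply: span_incl => //; exact: vge_refl.
  by rewrite !rmorph1 divr1.
have pE : (p%:R : {poly K})%:F = p%:R :> M by rewrite rmorph_nat.
have p0 : (p%:R : M) != 0 by rewrite -pE tofrac_eq0 -polyC_natr polyC_eq0 prime_neq0.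
have Ap : A p%:R.
  rewrite -pE -polyC_natr; apply: AK; rewrite vge_val ?prime_neq0// val_p; lra.
have nA : ~ A p%:R^-1.
  move=> [H [g [g0 [s [hs EH]] E]]].
  have EE : p%:R *: H = iP g.
    apply/eqP; rewrite -(@tofrac_eq {poly K}) -mul_polyC polyC_natr rmorphM /= pE.
    by rewrite -[H%:F](divfK (iP0 _ g0)) -E mulrA mulfV// mul1r.
  have /eqP := span_saturated (a := fun i => (tnth (in_tuple s) i).1)
    (f := fun i => (tnth (in_tuple s) i).2) g0
    (fun i => (hs _ (mem_tnth _ (in_tuple s))).1) (fun i => (hs _ (mem_tnth _ (in_tuple s))).2).
  by apply; rewrite -EE EH [in RHS]big_tnth.
have [B [AB hB nB]] := exists_valring sA Ap nA.
have sB := hB.1.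
exists B; split=> //.
- move=> c; split=> [Bc|]; last by move=> /AK/AB.
  have [//|nc] := boolP (vge v 0 c); exfalso; apply: nB.
  have c0 : c != 0 by apply: contraNneq nc => ->; rewrite vge0.
  rewrite vge_val// -ltNge in nc.
  (* With this [n], the constant c^-n / p is integral, and multiplying it by c^n gives 1/p. *)
  have [n hn] : exists n : nat, 1 <= n%:R * - v c.
    exists (Num.truncn (- v c)^-1).+1; rewrite -ler_pdivrMr ?oppr_gt0// mul1r ltW//.
    by apply: truncnS_gt.
  have -> : p%:R^-1 = ((c ^- n / p%:R)%:P)%:F * ((c%:P)%:F ^+ n) :> M.
    rewrite -rmorphXn -rmorphM /= -rmorphXn -rmorphM /= mulrAC mulVf ?expf_neq0// mul1r.
    by apply: (mulfI p0); rewrite mulfV// -{1}pE -rmorphM -polyC_natr -polyCM mulfV ?prime_neq0// !rmorph1.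
  apply: subringM => //; last exact: subringX.
  apply/AB/AK; rewrite vge_val ?mulf_neq0 ?invr_eq0 ?expf_neq0 ?prime_neq0//.
  rewrite val_div ?invr_eq0 ?expf_neq0 ?prime_neq0// fvalV ?expf_neq0// fvalX// val_p; lra.
- move=> f g f0 g0.
  have inB f' g' : f' != 0 -> g' != 0 -> u g' <= u f' -> B ((iP f')%:F / (iP g')%:F).
    move=> f'0 g'0 h; apply: AB; exists (iP f'), g'; split=> //.
    by apply: span_poly; rewrite vge_val.
  split; last exact: inB.
  move=> Bfg; rewrite leNgt; apply/negP => lt; apply: nB.
  have [n hn] : exists n : nat, 1 <= n%:R * (u g - u f).
    exists (Num.truncn (u g - u f)^-1).+1; rewrite -ler_pdivrMr ?subr_gt0// mul1r ltW//.
    by apply: truncnS_gt.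
  have -> : p%:R^-1 = ((iP (g ^+ n))%:F / (iP (p%:R%:P * f ^+ n))%:F) * (((iP f)%:F / (iP g)%:F) ^+ n) :> M.
    rewrite polyC_natr (rmorphM iP) !(rmorphXn iP) tofracM !tofracXn (rmorph_nat iP) pE.
    by apply: frac_cancel; rewrite ?iP0.
  apply: subringM => //; last exact: subringX.
  apply: inB; rewrite ?mulf_neq0 ?expf_neq0 ?polyC_eq0 ?rat_prime_neq0//.
  rewrite fvalM ?expf_neq0 ?polyC_eq0 ?rat_prime_neq0// !fvalX// uC ?rat_prime_neq0// vp_prime//; lra.
Qed.
End CommonExtension.

(** * Residues algebraic over the prime field *)

(** By finiteness, two powers X^(p^i) and X^(p^j) with i < j agree modulo [P], and in characteristic
    p their difference is the p^i-th power of X^(p^(j-i)) - X. [P] may be reducible or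
    inseparable. *)
Lemma polyFp_divides_frobenius p (P : {poly 'F_p}) : prime p -> P != 0 ->
  exists k n, (0 < k)%N /\ (P %| ('X^(p ^ k) - 'X) ^+ n).
Proof.
move=> pp P0; have chR : p \in [pchar {poly 'F_p}] by rewrite pchar_poly pchar_Fp.
pose r i : 'rV['F_p]_(size P) := poly_rV ('X^(p ^ i) %% P).
have [i [j [ij rij]]] : exists i j, (i < j)%N /\ r i = r j.
  pose N := #|{: 'rV['F_p]_(size P)}|.
  have /injectivePn[i [j ij E]] : ~~ injectiveb (fun i : 'I_N.+1 => r i).
    by apply/negP => /injectiveP/leq_card; rewrite card_ord ltnn.
  wlog lt : i j ij E / (i < j)%N.
    move=> H; have [|ji|/val_inj e] := ltngtP i j; first exact: H.
      by apply: (H j i) => //; rewrite eq_sym.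
    by rewrite e eqxx in ij.
  by exists i, j.
exists (j - i)%N, (p ^ i)%N; split; first by rewrite subn_gt0.
have Emod : 'X^(p ^ i) %% P = 'X^(p ^ j) %% P.
  have sz (h : {poly 'F_p}) : (size (h %% P)%R <= size P)%N by rewrite ltnW ?ltn_modp.
  by rewrite -[LHS](poly_rV_K (sz _)) -[RHS](poly_rV_K (sz _)) -/(r i) -/(r j) rij.
have -> : ('X^(p ^ (j - i)) - 'X) ^+ (p ^ i) = 'X^(p ^ j) - 'X^(p ^ i) :> {poly 'F_p}.
  have pn : [pchar {poly 'F_p}].-nat (p ^ i)%N by rewrite pnatX pnatE// chR.
  have := exprDn_pchar ('X^(p ^ (j - i)) - 'X) 'X pn.
  rewrite subrK -exprM -expnD subnK 1?ltnW// => ->.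
  by rewrite addrK.
by apply/modp_eq0P; rewrite modpD modpN -Emod subrr.
Qed.

Lemma lift_polyFp p (P : {poly 'F_p}) : exists H : {poly int}, map_poly intr H = P.
Proof.
exists (\poly_(i < size P) (val P`_i)%:Z); apply/polyP => i.
rewrite coef_map coef_poly; case: ltnP => [_|h]; last by rewrite nth_default.
by rewrite /= -[RHS]natr_Zp.
Qed.

Lemma polyFp_eq0 p (H : {poly int}) : prime p ->
  map_poly intr H = 0 :> {poly 'F_p} -> exists C : {poly int}, H = p%:Z *: C.
Proof.
move=> pp E; exists (\poly_(i < size H) (H`_i %/ p%:Z)%Z); apply/polyP => i.
rewrite coefZ coef_poly; case: ltnP => [_|h]; last by rewrite nth_default ?mulr0.
have := congr1 (fun h : {poly 'F_p} => h`_i) E; rewrite coef_map coef0 /= => /eqP.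
by rewrite -(dvdz_pcharf (pchar_Fp pp)) => /divzK; rewrite mulrC => ->.
Qed.

(** The previous divisibility lifted to Z: an element whose residue is a root of [P] has its residue
    fixed by a power of Frobenius. *)
Lemma frobenius_poly p (P : {poly int}) : prime p -> (exists i, ~~ (p%:Z %| P`_i)%Z) ->
  exists k n (A C : {poly int}), (0 < k)%N /\ ('X^(p ^ k) - 'X) ^+ n = P * A + p%:Z *: C.
Proof.
move=> pp [i Pi]; have P0 : map_poly intr P != 0 :> {poly 'F_p}.
  apply/eqP => E; move: Pi; have := congr1 (fun h : {poly 'F_p} => h`_i) E.
  by rewrite coef_map coef0 /= => /eqP; rewrite -(dvdz_pcharf (pchar_Fp pp)) => ->.
have [k [n [k0 /divpK E]]] := polyFp_divides_frobenius pp P0.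
have [A EA] := @lift_polyFp p (('X^(p ^ k) - 'X) ^+ n %/ map_poly intr P).
have [|C EC] := @polyFp_eq0 p (('X^(p ^ k) - 'X) ^+ n - P * A) pp.
  by rewrite rmorphB rmorphM rmorphXn rmorphB /= map_polyXn map_polyX EA mulrC E subrr.
by exists k, n, A, C; split=> //; rewrite -EC addrCA subrr addr0.
Qed.

Lemma int_max (Q : int -> Prop) (b : int) : (exists z, Q z) -> (forall z, Q z -> z <= b) ->
  exists2 z, Q z & forall z', Q z' -> z' <= z.
Proof.
move=> [z0 Qz0] ub.
have ex : exists n : nat, `[< Q (b - n%:Z) >].
  exists `|b - z0|%N; apply/asboolP; rewrite gez0_abs ?subr_ge0 ?ub//.
  by rewrite (_ : b - (b - z0) = z0)//; ring.
case: (ex_minnP ex) => n /asboolP Qn mn; exists (b - n%:Z) => // z' Qz'.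
have le := ub _ Qz'; have := mn `|b - z'|%N; rewrite gez0_abs ?subr_ge0//.
rewrite (_ : b - (b - z') = z'); last by ring.
move=> /(_ (asboolT Qz')) h.
have : n%:Z <= `|b - z'|%N%:Z by rewrite lez_nat.
by rewrite gez0_abs ?subr_ge0//; lra.
Qed.

Lemma primitive_integer_multiple p (P : {poly rat}) : prime p -> P != 0 ->
  exists (Z : {poly int}) (c : rat),
    (exists i, ~~ (p%:Z %| Z`_i)%Z) /\ map_poly intr Z = c *: P.
Proof.
move=> pp P0; have [q [a a0 E]] := rat_poly_scale P.
have q0 : q != 0 by apply: contraNneq P0 => q0; rewrite E q0 rmorph0 scaler0.
exists (zprimitive q), (a%:~R / (zcontents q)%:~R); split.
  apply/not_existsP => H.
  have : (p%:Z %| zcontents (zprimitive q))%Z.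
    rewrite dvdz_contents; apply/polyOverP => i.
    by apply/negPn/negP => /(H i).
  rewrite zcontents_primitive q0 dvdz1 /= => /eqP p1.
  by rewrite p1 in pp.
have c0 : ((zcontents q)%:~R : rat) != 0 by rewrite intr_eq0 zcontents_eq0.
have Eq : map_poly intr q = (zcontents q)%:~R *: map_poly intr (zprimitive q) :> {poly rat}.
  by rewrite {1}(zpolyEprim q) map_polyZ.
rewrite E Eq !scalerA -[LHS]scale1r; congr (_ *: _).
have a0' : (a%:~R : rat) != 0 by rewrite intr_eq0.
by field; rewrite c0 a0'.
Qed.

Section AlgebraicResidues.
Variables (p : nat) (K : closedFieldType) (v : K -> rat) (iota : {rmorphism rat -> K}).
Hypotheses (pp : prime p) (hv : is_val v).
Variables (M : fieldType) (B : M -> Prop) (j : {rmorphism K -> M}).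
Hypotheses (hB : is_valring B) (Bj : forall c, B (j c) <-> vge v 0 c).
Let sB : subring B := hB.1.

Lemma horner_sub (h : {poly M}) x y : coefs_in B h -> B x -> B y ->
  exists2 b, B b & h.[x] - h.[y] = (x - y) * b.
Proof.
move=> hh hx hy.
exists (\sum_(i < size h) h`_i * \sum_(l < i) x ^+ (i.-1 - l) * y ^+ l).
  apply: subring_sum => // i _; apply: subringM => //; apply: subring_sum => // l _.
  by apply: subringM => //; apply: subringX.
rewrite !horner_coef -sumrB big_distrr /=; apply: eq_bigr => i _.
by rewrite -mulrBr subrXX mulrCA.
Qed.

Lemma subring_int z : B z%:~R.
Proof.
have N n : B n%:R.
  elim: n => [|n IH]; first exact: subring0.
  by rewrite -addn1 natrD; apply: subringD => //; exact: subring1.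
by case: z => n; [exact: N | rewrite NegzE rmorphN; apply: (subringN sB); exact: N].
Qed.

Lemma coefs_in_int (P : {poly int}) : coefs_in B (map_poly intr P).
Proof. by move=> i; rewrite coef_map; exact: subring_int. Qed.

Lemma dlt_morph c : vgt v 0 c -> dlt B (j c) 1.
Proof.
have [->|c0] := eqVneq c 0; first by rewrite rmorph0 => _; apply/dlt0/oner_neq0.
rewrite vgt_val// => h; rewrite /dlt dle_div ?fmorph_eq0// div1r -fmorphV Bj.
rewrite vge_val ?invr_eq0// fvalV// oppr_ge0; apply/negP; rewrite -ltNge//.
Qed.

Lemma dle_morph c c' : c' != 0 -> dle B (j c) (j c') <-> vge v (v c') c.
Proof.
move=> c'0; rewrite dle_div ?fmorph_eq0// -fmorph_div Bj.
have [->|c0] := eqVneq c 0; first by rewrite mul0r !vge0.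
by rewrite !vge_val ?mulf_neq0 ?invr_eq0// val_div// subr_ge0.
Qed.

Hypothesis dense : forall (x : K) (n : nat), exists y, algebraic_over_Q y /\ close v n x y.

(** By density [r] may be replaced by some [r'] algebraic over Q. A primitive integer polynomial [P]
    vanishing at [r'] then has P(phi) divisible by phi - r'. The embedding [j] is left general so
    that the lemma applies to K(X) and also, through the identity, to [K] itself. *)
Lemma algebraic_residue phi r : B phi -> dlt B (phi - j r) 1 ->
  exists P : {poly int}, (exists i, ~~ (p%:Z %| P`_i)%Z) /\ dlt B (map_poly intr P).[phi] 1.
Proof.
move=> Bphi near_r; have [r' [[P0 [P00 rootP0]] rr']] := dense r 1.
have near_r' : dlt B (phi - j r') 1.
  rewrite -(subrKA (j r)); apply: dltD => //; rewrite -rmorphB; apply: dlt_morph.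
  case: rr' => [->|h]; first by rewrite subrr vgt0.
  by apply: vge_gt (_ : vge v 1 _) => //; rewrite /vge h orbT.
have [P [c [hP EP]]] := primitive_integer_multiple pp P00.
exists P; split=> //.
have Bone y : dlt B y 1 -> B y by move=> /(dltW hB); rewrite dle1.
have Br' : B (j r').
  have -> : j r' = phi - (phi - j r') by rewrite opprB addrC subrK.
  by apply: subringB => //; exact: Bone.
have [b Bb E] := horner_sub (coefs_in_int P) Bphi Br'.
have ratrE : ratr =1 iota by move=> q; rewrite fmorph_eq_rat.
have Pr' : (map_poly intr P).[j r'] = 0.
  have -> : map_poly intr P = map_poly j (map_poly iota (map_poly intr P)) :> {poly M}.
    by rewrite -!map_poly_comp; apply: eq_map_poly => z /=; rewrite !rmorph_int.
  rewrite EP map_polyZ horner_map; apply/eqP; rewrite fmorph_eq0 hornerZ mulf_eq0.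
  move: rootP0; rewrite /root (eq_map_poly ratrE) => ->; exact: orbT.
move: E; rewrite Pr' subr0 => ->; rewrite -[1]mulr1.
by apply: dltM => //; [rewrite dle1 | exact: oner_neq0].
Qed.
End AlgebraicResidues.

(** * Approximation of the variable by constants *)

Section Approximation.
Variables (p : nat) (K : closedFieldType) (v : K -> rat) (iota : {rmorphism rat -> K}).
Hypotheses (pp : prime p) (hv : is_val v).
Hypothesis vi : forall q, q != 0 -> v (iota q) = vp p q.

Lemma rat_of_val (z : int) : exists2 q : rat, q != 0 & v (iota q) = z%:~R.
Proof.
have p0 := rat_prime_neq0 pp.
have P n : v (iota (p%:R ^+ n)) = n%:R.
  by rewrite rmorphXn fvalX ?fmorph_eq0// vi// vp_prime// mulr1.
case: z => n; first by exists (p%:R ^+ n); rewrite ?expf_neq0.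
exists (p%:R ^- n.+1); first by rewrite invr_eq0 expf_neq0.
by rewrite fmorphV fvalV ?fmorph_eq0 ?expf_neq0// P NegzE rmorphN.
Qed.

(** The element is an n-th root of a rational number, with n the denominator of [r]. *)
Lemma elt_of_val (r : rat) : exists2 c : K, c != 0 & v c = r.
Proof.
have [q q0 vq] := rat_of_val (numq r).
pose n := `|denq r|%N.
have n0 : (0 < n)%N by rewrite absz_gt0 denq_neq0.
have [c rc] : exists c : K, root ('X^n - (iota q)%:P) c.
  by apply/closed_rootP; rewrite size_XnsubC//; case: (n) n0.
have Ec : c ^+ n = iota q.
  by move: rc; rewrite /root !hornerE subr_eq0 => /eqP.
have c0 : c != 0.
  apply: contraNneq q0 => c0; rewrite -(fmorph_eq0 iota) -Ec c0 expr0n.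
  by case: (n) n0.
exists c => //.
have : n%:R * v c = (numq r)%:~R by rewrite -fvalX// Ec.
move=> E; have nR : (n%:R : rat) != 0 by rewrite pnatr_eq0 -lt0n.
apply: (mulfI nR); rewrite E -[in RHS](divq_num_den r) mulrCA.
by rewrite [n%:R](_ : _ = (denq r)%:~R) ?divff ?mulr1 ?intr_eq0 ?denq_neq0// -[LHS]/(n%:Z%:~R) absz_denq.
Qed.

Variable u : {poly rat} -> rat.
Hypotheses (hu : is_val u) (uC : forall q, q != 0 -> u q%:P = vp p q).
Variable e : nat.
Hypothesis e0 : (0 < e)%N.
Hypothesis ue : forall f, f != 0 -> exists z : int, e%:R * u f = z%:~R.

Local Notation iP := (map_poly iota).
Variables (M : fieldType) (T : {rmorphism {poly K} -> M}).
Hypothesis T_inj : injective T.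
Local Notation "h %:F" := (T h).
Variable B : M -> Prop.
Hypotheses (hB : is_valring B) (BK : forall c : K, B (c%:P)%:F <-> vge v 0 c).
Hypothesis BQ : forall f g, f != 0 -> g != 0 -> B ((iP f)%:F / (iP g)%:F) <-> u g <= u f.

Definition cst (c : K) : M := (c%:P)%:F.
HB.instance Definition _ := GRing.RMorphism.copy cst (T \o polyC).

Definition iQ (f : {poly rat}) : M := (iP f)%:F.
HB.instance Definition _ := GRing.RMorphism.copy iQ (T \o iP).

Local Notation dle := (dle B).
Local Notation dlt := (dlt B).
Local Notation deq := (deq B).
Local Notation near := (near B).

Definition lin (b : K) : M := ('X - b%:P)%:F.

Lemma T_eq0 h : (h%:F == 0) = (h == 0).
Proof. by rewrite -(rmorph0 T) (inj_eq T_inj). Qed.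
Lemma iQ_neq0 f : f != 0 -> iQ f != 0.
Proof. by rewrite T_eq0 map_poly_eq0. Qed.
Lemma cst_neq0 c : c != 0 -> cst c != 0.
Proof. by rewrite fmorph_eq0. Qed.
Lemma iQC q : iQ q%:P = cst (iota q).
Proof. by rewrite /iQ map_polyC. Qed.

Lemma dle_cst c c' : c' != 0 -> dle (cst c) (cst c') <-> vge v (v c') c.
Proof. exact: dle_morph. Qed.
Lemma dlt_cst c c' : c != 0 -> c' != 0 -> v c' < v c -> dlt (cst c) (cst c').
Proof.
by move=> c0 c'0 h; rewrite /dlt dle_cst// vge_val//; apply/negP; rewrite -ltNge.
Qed.
Lemma dlt1_cst c : vgt v 0 c -> dlt (cst c) 1.
Proof. exact: dlt_morph. Qed.
Lemma deq_cst c c' : c != 0 -> c' != 0 -> v c = v c' -> deq (cst c) (cst c').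
Proof. by move=> c0 c'0 h; split; apply/dle_cst; rewrite // vge_val// h. Qed.
Lemma dle_iQ f g : f != 0 -> g != 0 -> dle (iQ f) (iQ g) <-> u g <= u f.
Proof. by move=> f0 g0; rewrite dle_div ?iQ_neq0//; exact: BQ. Qed.

(** A partial valuation: elements infinitely small with respect to [K], which [B] may admit, have no
    value. *)
Definition hasval (x : M) (r : rat) := exists c, [/\ c != 0, v c = r & deq x (cst c)].

Lemma hasval_neq0 x r : hasval x r -> x != 0.
Proof. by move=> [c [c0 _ /deq_sym/deq_neq0]]; apply; exact: cst_neq0. Qed.
Lemma hasval_cst c : c != 0 -> hasval (cst c) (v c).
Proof. by move=> c0; exists c; split=> //; apply: deq_refl. Qed.
Lemma hasval_deq x y r : deq x y -> hasval x r -> hasval y r.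
Proof.
by move=> xy [c [c0 vc xc]]; exists c; split=> //; apply: deq_trans xc => //; exact: deq_sym.
Qed.
Lemma hasval_dle x y r s : hasval x r -> hasval y s -> dle x y <-> s <= r.
Proof.
move=> [c [c0 <- [xc cx]]] [c' [c'0 <- [yc' c'y]]]; rewrite -(vge_val v _ c0) -dle_cst//.
split=> h; first by apply: dle_trans (dle_trans hB h yc').
by apply: dle_trans xc _ => //; apply: dle_trans h c'y.
Qed.
Lemma hasval_dlt x y r s : hasval x r -> hasval y s -> dlt x y <-> s < r.
Proof.
by move=> hx hy; rewrite /dlt (hasval_dle hy hx) ltNge; split=> /negP.
Qed.
Lemma hasval_inj x r s : hasval x r -> hasval x s -> r = s.
Proof.
move=> h1 h2; apply/eqP; rewrite eq_le; apply/andP; split.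
  by apply/(hasval_dle h2 h1); apply: dle_refl.
by apply/(hasval_dle h1 h2); apply: dle_refl.
Qed.
Lemma hasvalM x y r s : hasval x r -> hasval y s -> hasval (x * y) (r + s).
Proof.
move=> [c [c0 <- xc]] [c' [c'0 <- yc']]; exists (c * c'); rewrite mulf_neq0// fvalM//.
by split=> //; rewrite rmorphM; apply: deqM.
Qed.
Lemma hasvalV x r : hasval x r -> hasval x^-1 (- r).
Proof.
move=> h; have x0 := hasval_neq0 h; case: h => c [c0 <- xc]; exists c^-1.
rewrite invr_eq0 c0 fvalV//; split=> //; rewrite fmorphV; apply: (deqV hB) => //.
exact: cst_neq0.
Qed.
Lemma hasvalX_inv x n r : (0 < n)%N -> hasval (x ^+ n) r -> hasval x (r / n%:R).
Proof.
move=> n0 [c [c0 vc xc]]; have [c' c'0 vc'] := elt_of_val (r / n%:R).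
exists c'; split=> //; apply: (deqX_inv hB n0); apply: deq_trans xc _ => //.
rewrite -rmorphXn; apply: deq_cst; rewrite ?expf_neq0// fvalX// vc vc'.
by rewrite mulrCA mulfV ?mulr1// pnatr_eq0 -lt0n.
Qed.

(** The power f^e has integral value, so it can be compared inside Q(X) with a rational constant;
    taking e-th roots of orders gives the value of [f]. *)
Lemma hasval_iQ f : f != 0 -> hasval (iQ f) (u f).
Proof.
move=> f0; have [z ez] := ue f0; have [q q0 vq] := rat_of_val z.
have uq : u q%:P = z%:~R by rewrite uC// -vi.
have -> : u f = z%:~R / e%:R by rewrite -ez mulrAC mulfV ?mul1r// pnatr_eq0 -lt0n.
apply: hasvalX_inv => //; exists (iota q); rewrite fmorph_eq0; split=> //.
rewrite -iQC -rmorphXn; split; apply/dle_iQ; rewrite ?expf_neq0 ?polyC_eq0//;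
  by rewrite fvalX// ez uq.
Qed.

Lemma lin_sub b b' : lin b - lin b' = cst (b' - b).
Proof.
rewrite /lin /cst -rmorphB; congr (_%:F).
by rewrite polyCB; ring.
Qed.

Lemma prodF (s : seq K) c : (c *: \prod_(b <- s) ('X - b%:P))%:F = cst c * \prod_(b <- s) lin b.
Proof. by rewrite -mul_polyC rmorphM rmorph_prod. Qed.

Lemma cst_bound x y : (exists2 c, c != 0 & dle x (cst c)) -> (exists2 c, c != 0 & dle y (cst c)) ->
  exists c, [/\ c != 0, dle x (cst c) & dle y (cst c)].
Proof.
move=> [c c0 xc] [d d0 yd]; have [cd|dc] := dle_total hB (cst c) (cst d).
  by exists d; split=> //; apply: dle_trans cd.
by exists c; split=> //; apply: dle_trans dc.
Qed.

Lemma poly_bounded (h : {poly K}) : exists2 c, c != 0 & dle h%:F (cst c).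
Proof.
have [cX cX0 hX] : exists2 c, c != 0 & dle 'X%:F (cst c).
  have [c [c0 _ [h' _]]] := hasval_iQ (negbT (polyX_eq0 rat)).
  by exists c => //; move: h'; rewrite /iQ map_polyX.
elim/poly_ind: h => [|h a [c c0 hc]].
  by exists 1; rewrite ?oner_neq0// rmorph0; apply: dle0.
have h1 : exists2 c, c != 0 & dle (h * 'X)%:F (cst c).
  exists (c * cX); rewrite ?mulf_neq0// !rmorphM; exact: dleM.
have h2 : exists2 c, c != 0 & dle (cst a) (cst c).
  have [->|a0] := eqVneq a 0; last by exists a => //; apply: dle_refl.
  by exists 1; rewrite ?oner_neq0// rmorph0; apply: dle0.
by have [d [d0 k1 k2]] := cst_bound h1 h2; exists d => //; rewrite rmorphD; apply: dleD.
Qed.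

Lemma eval_sub (h : {poly K}) a : exists g : {poly K}, h%:F - cst h.[a] = lin a * g%:F.
Proof.
have : root (h - (h.[a])%:P) a by rewrite /root !hornerE subrr.
by move=> /factor_theorem[g E]; exists g; rewrite /cst -rmorphB E rmorphM mulrC.
Qed.

Lemma near_cst_val f c : f != 0 -> near (iQ f) (cst c) -> c != 0 /\ v c = u f.
Proof.
move=> f0 h; have c0 : c != 0.
  by have := near_neq0 hB (near_sym hB h); rewrite fmorph_eq0.
split=> //; apply: hasval_inj (hasval_cst c0) _.
exact: hasval_deq (near_deq hB h) (hasval_iQ f0).
Qed.

(** f(X) - f(a) is X - a times a cofactor bounded by a constant, hence smaller than every constant,
    whereas f(X) has the order of a constant. Below, [d] is chosen to make the value of [d * c]
    exceed [u f] by 1. *)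
Lemma near_eval_of_inf a f : (forall c, c != 0 -> dle (lin a) (cst c)) -> f != 0 ->
  near (iQ f) (cst (iP f).[a]).
Proof.
move=> inf f0; have [g E] := eval_sub (iP f) a; rewrite /near E.
have [c c0 gc] := poly_bounded g; have [d d0 vd] := elt_of_val (u f - v c + 1).
have vdc : hasval (cst (d * c)) (u f + 1).
  have -> : u f + 1 = v (d * c) by rewrite fvalM// vd; ring.
  by apply: hasval_cst; rewrite mulf_neq0.
apply: (@dle_lt_trans _ _ hB (cst (d * c))).
  by rewrite rmorphM; apply: dleM => //; apply: inf.
by apply/(hasval_dlt vdc (hasval_iQ f0)); lra.
Qed.

(** If [b] is closer to X than a root b', then X - b' is near b - b'; the factors are then
    multiplied. *)
Lemma near_eval_of_closer b f : f != 0 ->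
  (forall b', root (iP f) b' -> dlt (lin b) (lin b')) -> near (iQ f) (cst (iP f).[b]).
Proof.
move=> f0 h; have iP0 : iP f != 0 by rewrite map_poly_eq0.
have [s E Es] := factor_poly iP0.
rewrite /iQ {1}E prodF {2}E hornerZ horner_prod rmorphM rmorph_prod.
apply: nearM => //; first by apply/near_refl/cst_neq0; rewrite lead_coef_eq0.
rewrite big_seq [X in near _ X]big_seq; elim/big_ind2: _ => [|x1 x2 y1 y2|b' b's].
- exact/near_refl/oner_neq0.
- exact: nearM.
- rewrite !hornerE /near; have -> : lin b' - cst (b - b') = lin b.
    by rewrite -lin_sub opprB addrCA subrr addr0.
  by apply: h; rewrite Es.
Qed.

Lemma closest_of_seq (s : seq K) b0 : (forall b, exists b', dlt (lin b') (lin b)) ->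
  exists b, forall b', b' \in b0 :: s -> dlt (lin b) (lin b').
Proof.
move=> H; elim: s => [|a s [b hb]].
  by have [b hb] := H b0; exists b => b'; rewrite inE => /eqP ->.
have [c hc] := H a; have [bc|cb] := dle_total hB (lin b) (lin c).
  exists b => b'; rewrite !inE => /or3P[/eqP ->|/eqP ->|b's].
  - by apply: hb; rewrite mem_head.
  - exact: dle_lt_trans hc.
  - by apply: hb; rewrite inE b's orbT.
exists c => b'; rewrite !inE => /or3P[/eqP ->|/eqP ->|b's] //.
- by apply: dle_lt_trans cb _ => //; apply: hb; rewrite mem_head.
- by apply: dle_lt_trans cb _ => //; apply: hb; rewrite inE b's orbT.
Qed.

Lemma near_eval_pair f g : f != 0 -> g != 0 -> (forall b, exists b', dlt (lin b') (lin b)) ->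
  exists b, near (iQ f) (cst (iP f).[b]) /\ near (iQ g) (cst (iP g).[b]).
Proof.
move=> f0 g0 H.
have [s _ Es] := factor_poly (negbT (etrans (map_poly_eq0 iota f) (negPf f0))).
have [t _ Et] := factor_poly (negbT (etrans (map_poly_eq0 iota g) (negPf g0))).
have [b hb] := closest_of_seq (s ++ t) 0 H; exists b.
split; apply: near_eval_of_closer => // b'; rewrite ?Es ?Et => h; apply: hb;
  by rewrite inE mem_cat h !orbT.
Qed.

Definition isQ (x : M) := exists f g, g != 0 /\ x = iQ f / iQ g.

Lemma isQ_iQ f : isQ (iQ f).
Proof. by exists f, 1; rewrite oner_neq0 rmorph1 divr1. Qed.

Lemma isQ_subring : subring isQ.
Proof.
split=> [|x y|x y].
- by rewrite -(rmorph1 iQ); exact: isQ_iQ.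
- move=> [f [g [g0 ->]]] [f' [g' [g'0 ->]]]; exists (f * g' - f' * g), (g * g').
  by rewrite mulf_neq0// rmorphB !rmorphM fracB ?iQ_neq0.
- move=> [f [g [g0 ->]]] [f' [g' [g'0 ->]]]; exists (f * f'), (g * g').
  by rewrite mulf_neq0// !rmorphM mulf_div.
Qed.

Lemma isQ_div x y : isQ x -> isQ y -> isQ (x / y).
Proof.
move=> [f [g [g0 ->]]] [f' [g' [g'0 ->]]].
have [->|f'0] := eqVneq f' 0.
  by rewrite rmorph0 mul0r invr0 mulr0; apply: (subring0 isQ_subring).
by exists (f * g'), (g * f'); rewrite mulf_neq0// !rmorphM invf_div mulf_div.
Qed.

Lemma isQ_val x : isQ x -> x != 0 -> exists r (z : int), hasval x r /\ e%:R * r = z%:~R.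
Proof.
move=> [f [g [g0 ->]]] x0; have f0 : f != 0.
  by apply: contraNneq x0 => ->; rewrite rmorph0 mul0r.
have [z ez] := ue f0; have [z' ez'] := ue g0.
exists (u f - u g), (z - z'); rewrite mulrBr ez ez' rmorphB; split=> //.
exact/hasvalM/hasvalV/hasval_iQ/g0/hasval_iQ.
Qed.

Lemma isQ_bounded x : isQ x -> exists2 c, c != 0 & dle x (cst c).
Proof.
have [-> _|x0 /isQ_val/(_ x0)[r [_ [[c [c0 _ [h _]]] _]]]] := eqVneq x 0; last by exists c.
by exists 1; [exact: oner_neq0 | exact: dle0].
Qed.

(** The closure of Q(X) for the topology in which the neighbourhoods of 0 are given by the nonzero
    constants of [K]. *)
Definition appr (z : M) := forall c, c != 0 -> exists2 x, isQ x & dle (z - x) (cst c).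

Lemma appr_isQ x : isQ x -> appr x.
Proof. by move=> hx c _; exists x; rewrite ?subrr//; apply: dle0. Qed.

Lemma appr_bounded z : appr z -> exists2 c, c != 0 & dle z (cst c).
Proof.
move=> /(_ 1 (oner_neq0 _))[x qx hx].
have b1 : exists2 c, c != 0 & dle (z - x) (cst c) by exists 1; rewrite ?oner_neq0.
have [c [c0 h1 h2]] := cst_bound b1 (isQ_bounded qx).
by exists c => //; rewrite -(subrK x z); apply: dleD.
Qed.

Lemma appr_subring : subring appr.
Proof.
split=> [|x y hx hy c c0|x y hx hy c c0].
- exact/appr_isQ/(subring1 isQ_subring).
- have [a qa ha] := hx c c0; have [b qb hb] := hy c c0.
  exists (a - b); first exact: (subringB isQ_subring).
  rewrite (_ : x - y - (a - b) = (x - a) - (y - b)); last by ring.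
  exact: dleB.
- have [cx cx0 hcx] := appr_bounded hx.
  have [b qb hb] := hy (c / cx) (mulf_neq0 c0 (invr_neq0 cx0)).
  have [cb cb0 hcb] := isQ_bounded qb.
  have [a qa ha] := hx (c / cb) (mulf_neq0 c0 (invr_neq0 cb0)).
  exists (a * b); first exact: (subringM isQ_subring).
  rewrite (_ : x * y - a * b = (y - b) * x + (x - a) * b); last by ring.
  apply: dleD => //.
    by rewrite -[c](divfK cx0) rmorphM; apply: dleM.
  by rewrite -[c](divfK cb0) rmorphM; apply: dleM.
Qed.

(** This is how discreteness passes from Q(X) to its closure; the lower bound by a constant excludes
    infinitely small elements. *)
Lemma near_of_appr z c : appr z -> c != 0 -> dle (cst c) z -> exists2 x, isQ x & near z x.
Proof.
move=> hz c0 cz; have [d d0 vd] := elt_of_val (v c + 1).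
have [x qx hx] := hz d d0; exists x => //.
apply: (dlt_le_trans hB) cz; apply: (dle_lt_trans hB) hx _.
by apply: dlt_cst => //; rewrite vd; lra.
Qed.

Lemma appr_poly (h : {poly K}) : (forall i, appr (cst h`_i)) -> appr h%:F.
Proof.
move=> hh; rewrite -[h]coefK poly_def rmorph_sum; apply: (subring_sum appr_subring) => i _.
rewrite -mul_polyC rmorphM; apply: (subringM appr_subring); first exact: hh.
rewrite rmorphXn; apply/(subringX appr_subring)/appr_isQ.
by have := isQ_iQ 'X; rewrite /iQ map_polyX.
Qed.

Lemma pM_lt1 : dlt p%:R 1.
Proof.
rewrite -(rmorph_nat cst); apply: dlt1_cst.
by rewrite vgt_val ?(prime_neq0 iota pp)// (val_p pp vi).
Qed.

(** Each p-th power gains a factor [pi]: the cofactor (x^p - y^p) / (x - y) is congruent modulo x -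
    y to p y^(p-1), and both x - y and p are multiples of [pi]. *)
Lemma pow_close x y (pi : M) n k : B x -> B y -> B pi -> dle p%:R pi ->
  (0 < n)%N -> dle (x - y) (pi ^+ n) -> dle (x ^+ (p ^ k) - y ^+ (p ^ k)) (pi ^+ (n + k)).
Proof.
move=> Bx By Bpi ppi n0 h; have sB := hB.1.
elim: k => [|k IH]; first by rewrite addn0 !expr1.
rewrite expnSr !exprM addnS; move: IH.
have : B (x ^+ (p ^ k)) by exact: subringX.
have : B (y ^+ (p ^ k)) by exact: subringX.
move: (x ^+ (p ^ k)) (y ^+ (p ^ k)) => {}x {}y {}By {}Bx {}h.
have lepi : dle (pi ^+ (n + k)) pi.
  case: (n) n0 => // m _; rewrite addSn exprS -[X in dle _ X]mulr1; apply: dleM => //.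
    exact: dle_refl.
  by rewrite dle1; apply: subringX.
pose Q : {poly M} := \sum_(i < p) y ^+ i *: 'X^(p.-1 - i).
have hQ : coefs_in B Q.
  move=> i; rewrite coef_sum; apply: subring_sum => // l _; rewrite coefZ coefXn.
  by apply: subringM; [| exact: subringX | case: eqP => _; [exact: subring1 | exact: subring0]].
have Qz z : Q.[z] = \sum_(i < p) z ^+ (p.-1 - i) * y ^+ i.
  by rewrite horner_sum; apply: eq_bigr => i _; rewrite hornerZ hornerXn mulrC.
have Qy : Q.[y] = p%:R * y ^+ p.-1.
  rewrite Qz (eq_bigr (fun=> y ^+ p.-1)); last first.
    move=> i _; rewrite -exprD subnK// -ltnS prednK ?prime_gt0//.
  by rewrite sumr_const card_ord mulr_natl.
rewrite subrXX -Qz exprSr; apply: dleM => //.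
have [b Bb E] := horner_sub hB hQ Bx By.
rewrite -[Q.[x]](subrK Q.[y]) E Qy; apply: dleD => //.
  rewrite -[pi]mulr1; apply: dleM => //; last by rewrite dle1.
  exact: dle_trans lepi.
by rewrite -[pi]mulr1; apply: dleM => //; rewrite dle1; apply: subringX.
Qed.

(** * The residually algebraic case: Teichmueller elements and constants close to X *)

Section ResidueAlgebraic.
Hypothesis res : forall x, isQ x -> B x ->
  exists P : {poly int}, (exists i, ~~ (p%:Z %| P`_i)%Z) /\ dlt (map_poly intr P).[x] 1.

Lemma residue_frobenius x : isQ x -> B x -> exists2 k, (0 < k)%N & dlt (x ^+ (p ^ k) - x) 1.
Proof.
move=> qx Bx; have [P [hP Px]] := res qx Bx.
have [k [n [A [C [k0 E]]]]] := frobenius_poly pp hP; exists k => //.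
apply: (@dltX_inv _ _ hB _ _ n); rewrite expr1n.
have -> : (x ^+ (p ^ k) - x) ^+ n =
    (map_poly intr P).[x] * (map_poly intr A).[x] + p%:R * (map_poly intr C).[x].
  have := congr1 (fun h : {poly int} => (map_poly (intr : int -> M) h).[x]) E.
  rewrite rmorphXn rmorphB /= map_polyXn map_polyX rmorphD rmorphM /= map_polyZ.
  by rewrite !hornerE.
have int1 (H : {poly int}) : dle (map_poly intr H).[x] 1.
  by rewrite dle1; apply: horner_in; [exact: hB.1 | exact: coefs_in_int |].
apply: dltD => //; rewrite -[X in dlt _ X]mulr1.
  exact: dltM Px (int1 _) (oner_neq0 _).
exact: dltM pM_lt1 (int1 _) (oner_neq0 _).
Qed.

Lemma prod_lower_bound (s : seq K) (phi : nat -> M) :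
  (forall c, c \in s -> exists2 d, d != 0 & forall m, dle (cst d) (phi m - cst c)) ->
  exists2 d, d != 0 & forall m, dle (cst d) (\prod_(c <- s) (phi m - cst c)).
Proof.
elim: s => [|c s IH] h.
  by exists 1; rewrite ?oner_neq0// => m; rewrite big_nil rmorph1; exact: dle_refl.
have [d d0 hd] := h c (mem_head _ _).
have [|d' d'0 hd'] := IH; first by move=> b bs; apply: h; rewrite inE bs orbT.
exists (d * d'); rewrite ?mulf_neq0// => m; rewrite big_cons rmorphM; exact: dleM.
Qed.

(** The powers x^(q^m) form a Cauchy sequence, whose limit is sought among the roots in [K] of X^q -
    X. The product of the distances from x^(q^m) to these roots is x^(q^(m+1)) - x^(q^m), which
    tends to 0. A root outside the closure stays away from every element of Q(X), and one with |x -
    c| >= 1 stays away from the whole sequence; if all roots were of these kinds, the product would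
    be bounded below. *)
Lemma teichmuller x : isQ x -> B x -> exists2 c, appr (cst c) & dlt (x - cst c) 1.
Proof.
move=> qx Bx; have [k k0 hk] := residue_frobenius qx Bx.
have sB := hB.1; pose q := (p ^ k)%N.
have q1 : (1 < q)%N by rewrite -[1%N](expn0 p) ltn_exp2l ?prime_gt1.
have eR : (0 : rat) < e%:R by rewrite ltr0n.
(* 1/e bounds from below the positive values on Q(X), so [pi] divides both x^q - x and p. *)
have [pi pi0 vpi] := elt_of_val e%:R^-1.
have Bpi : B (cst pi) by apply/BK; rewrite vge_val// vpi invr_ge0 ltW.
have pi1 : dlt (cst pi) 1 by apply: dlt1_cst; rewrite vgt_val// vpi invr_gt0.
have ppi : dle p%:R (cst pi).
  rewrite -(rmorph_nat cst); apply/dle_cst => //.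
  rewrite vge_val ?(prime_neq0 iota pp)// (val_p pp vi) vpi invf_le1// ler1n//.
have D0 : dle (x ^+ q - x) (cst pi).
  have [->|y0] := eqVneq (x ^+ q - x) 0; first exact: dle0.
  have [|r [z [hr er]]] := isQ_val _ y0.
    by apply: (subringB isQ_subring) => //; exact: (subringX isQ_subring).
  apply/(hasval_dle hr (hasval_cst pi0)); rewrite vpi -[r](mulKf (lt0r_neq0 eR)) er.
  rewrite ler_pMr ?invr_gt0// -[1]/(1%:~R) ler_int.
  have h1 : hasval 1 0 by rewrite -(rmorph1 cst) -(fval1 hv); apply/hasval_cst/oner_neq0.
  have /(hasval_dlt hr h1) rpos := hk.
  have : (0 : rat) < z%:~R by rewrite -er mulr_gt0.
  by rewrite ltr0z.
pose phi m := x ^+ (q ^ m).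
have D m : dle (phi m.+1 - phi m) (cst pi ^+ m.+1).
  rewrite /phi expnS exprM /q -expnM.
  (* The exponent obtained is 1 + k m, at least m + 1 because k > 0. *)
  have := pow_close (k * m) (subringX sB q Bx) Bx Bpi ppi (ltnSn 0) D0.
  move/(dle_trans hB); apply; rewrite -(subnK (_ : m.+1 <= 1 + k * m)%N).
    rewrite exprD -[X in dle _ X]mul1r; apply: dleM (dle_refl _ _) => //.
    by rewrite dle1; apply: subringX.
  by rewrite add1n ltnS leq_pmull.
have N m : dle (phi m - x) (cst pi).
  elim: m => [|m IH]; first by rewrite /phi expn0 expr1 subrr; exact: dle0.
  rewrite -(subrKA (phi m)); apply: dleD => //; apply: dle_trans (D m) _ => //.
  rewrite exprS -[X in dle _ X]mulr1; apply: dleM => //; first exact: dle_refl.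
  by rewrite dle1; apply: subringX.
have [s Es] : exists s : seq K, 'X^q - 'X = \prod_(c <- s) ('X - c%:P).
  have [s E] := closed_field_poly_normal ('X^q - 'X : {poly K}); exists s.
  suff -> : \prod_(c <- s) ('X - c%:P) = lead_coef ('X^q - 'X) *: \prod_(c <- s) ('X - c%:P).
    by [].
  rewrite lead_coefDl ?lead_coefXn ?scale1r//.
  by rewrite size_polyXn size_polyN size_polyX.
have prodE y : y ^+ q - y = \prod_(c <- s) (y - cst c).
  have := congr1 (fun h => (map_poly cst h).[y]) Es.
  rewrite rmorphB /= map_polyXn map_polyX !hornerE => ->.
  rewrite rmorph_prod horner_prod; apply: eq_bigr => c _.
  by rewrite /= map_polyXsubC hornerXsubC.
apply: contrapT => H.
have [|d d0 hd] := @prod_lower_bound s phi.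
  move=> c _; have [ac|nac] := pselect (appr (cst c)); last first.
    apply: contrapT => Hd; apply: nac => d d0; apply: contrapT => Hx; apply: Hd.
    exists d => // m; have [//|h] := dle_or_lt B (cst d) (phi m - cst c).
    case: Hx; exists (phi m); first exact: (subringX isQ_subring).
    by apply: dle_sub => //; exact: dltW.
  exists 1; rewrite ?oner_neq0// rmorph1 => m.
  have [//|h] := dle_or_lt B 1 (phi m - cst c); case: H; exists c => //.
  rewrite -(subrKA (phi m)); apply: dltD => //; apply: dlt_sub => //.
  exact: dle_lt_trans (N m) pi1.
have bound m : m.+1%:R <= e%:R * v d.
  have : dle (cst d) (cst (pi ^+ m.+1)).
    rewrite rmorphXn; apply: dle_trans (D m) => //.
    have -> : phi m.+1 - phi m = phi m ^+ q - phi m by rewrite /phi expnSr exprM.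
    by rewrite prodE; exact: hd.
  rewrite dle_cst ?expf_neq0// vge_val// fvalX// vpi => h.
  by rewrite -ler_pdivrMl// mulrC.
have := bound (Num.truncn (e%:R * v d)); rewrite leNgt => /negP; apply.
exact: truncnS_gt.
Qed.

Lemma close_points c0 : c0 != 0 -> exists b, dle (lin b) (cst c0).
Proof.
move=> c00; apply: contrapT => Hno.
have far b : dle (cst c0) (lin b).
  by have [//|/(dltW hB) h] := dle_or_lt B (cst c0) (lin b); case: Hno; exists b.
have eR : (0 : rat) < e%:R by rewrite ltr0n.
have en0 := lt0r_neq0 eR.
(* A monic polynomial splits into factors X - b, none of which is smaller than [c0]. This keeps the
   values of monic polynomials of degree [d] bounded above. *)
have lower (h : {poly K}) d : h \is monic -> size h = d.+1 -> dle (cst (c0 ^+ d)) h%:F.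
  move=> mh sh; have [s Es _] := factor_poly (monic_neq0 mh).
  move: Es; rewrite (monicP mh) scale1r => Es.
  have ds : d = size s by apply: succn_inj; rewrite -sh Es size_prod_XsubC.
  rewrite Es rmorph_prod ds; elim: (s) => [|b t IH].
    by rewrite big_nil expr0 rmorph1; exact: dle_refl.
  by rewrite big_cons exprS rmorphM; apply: dleM => //; exact: far.
(* Values are recorded as integers [z], standing for z / e, so that a bounded set of them has a
   maximum. *)
pose good d (h : {poly K}) (z : int) :=
  [/\ h \is monic, size h = d.+1, forall i, appr (cst h`_i) & hasval h%:F (z%:~R / e%:R)].
have goodP d h : h \is monic -> size h = d.+1 -> (forall i, appr (cst h`_i)) ->
    exists z, good d h z.
  move=> mh sh ah; have [x qx nx] := near_of_appr (appr_poly ah) (expf_neq0 d c00) (lower h d mh sh).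
  have x0 := near_neq0 hB (near_sym hB nx).
  have [r [z [hr er]]] := isQ_val qx x0; exists z; split=> //.
  have -> : z%:~R / e%:R = r by rewrite -er mulrAC mulfV ?mul1r.
  by apply: hasval_deq hr; apply/deq_sym/near_deq.
have maxE d : exists hz : {poly K} * int, good d hz.1 hz.2 /\
    forall h z, good d h z -> z <= hz.2.
  have [||z [h hz] mz] := @int_max (fun z => exists h, good d h z) (Num.ceil (e%:R * v (c0 ^+ d))).
  - have [||i|z hz] := goodP d 'X^d.
    + exact: monicXn.
    + by rewrite size_polyXn.
    + rewrite coefXn; case: eqP => _; rewrite ?rmorph1 ?rmorph0.
        exact: (subring1 appr_subring).
      exact: (subring0 appr_subring).
    + by exists z, 'X^d.
  - move=> z [h [mh sh _ hz]]; have := lower h d mh sh.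
    move=> /(hasval_dle (hasval_cst (expf_neq0 d c00)) hz); rewrite ler_pdivrMr// mulrC => le.
    by rewrite -(ler_int rat); apply: le_trans le (Num.Theory.ceil_ge _).
  - by exists (h, z); split=> // h' z' gz'; apply: mz; exists h'.
have [G hG] := choice maxE.
(* The e + 1 degrees fall into e classes of [z] modulo e, that is, of values modulo Z. *)
pose cl (i : 'I_e.+1) : 'I_e := Ordinal (ltn_pmod `|((G i).2 %% e%:Z)%Z|%N e0).
have /injectivePn[i [j ij E]] : ~~ injectiveb cl.
  by apply/negP => /injectiveP/leq_card; rewrite !card_ord ltnn.
wlog lt : i j ij E / (i < j)%N.
  move=> H; have [|ji|/val_inj e'] := ltngtP i j; first exact: H.
    by apply: (H j i) => //; rewrite eq_sym.
  by rewrite e' eqxx in ij.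
have [k Ek] : exists k : int, (G j).2 - (G i).2 = k * e%:Z.
  have ez : e%:Z != 0 by rewrite eqz_nat -lt0n.
  have M0 z : `|(z %% e%:Z)%Z|%N = (`|(z %% e%:Z)%Z| %% e)%N.
    by rewrite modn_small// -ltz_nat gez0_abs ?modz_ge0// ltz_pmod// ltz_nat.
  have /dvdzP[k Ek] : (e%:Z %| (G j).2 - (G i).2)%Z.
    rewrite -eqz_mod_dvd; apply/eqP.
    have := congr1 val E; rewrite /= -!M0 => /(congr1 Posz).
    by rewrite !gez0_abs ?modz_ge0.
  by exists k.
have [[mi si ai vi'] _] := hG i; have [[mj sj aj vj] maxj] := hG j.
move: Ek mi si ai vi' mj sj aj vj maxj.
move: (G i).1 (G i).2 (G j).1 (G j).2 => gi zi gj zj Ek mi si ai hvi mj sj aj hvj maxj.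
(* The scaling factor is rational, so multiplying by it preserves coefficients in the closure. *)
have [w w0 vw] := rat_of_val k.
have hw : hasval (cst (iota w)) k%:~R by rewrite -vw; apply: hasval_cst; rewrite fmorph_eq0.
have hden : hasval (cst (iota w) * gi%:F) (zj%:~R / e%:R).
  have -> : zj%:~R / e%:R = k%:~R + zi%:~R / e%:R :> rat.
    have -> : zj = k * e%:Z + zi by rewrite -Ek subrK.
    by rewrite rmorphD rmorphM /= mulrDl mulfK.
  exact: hasvalM.
set t := gj%:F / (cst (iota w) * gi%:F).
have ht : hasval t 0.
  by rewrite -(subrr (zj%:~R / e%:R : rat)); apply: hasvalM => //; apply: hasvalV.
have [x qx ntx] : exists2 x, isQ x & near t x.
  have [a qa na] := near_of_appr (appr_poly aj) (expf_neq0 j c00) (lower _ _ mj sj).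
  have [b qb nb] := near_of_appr (appr_poly ai) (expf_neq0 i c00) (lower _ _ mi si).
  exists (a / (cst (iota w) * b)).
    by apply: isQ_div => //; apply: (subringM isQ_subring) => //; rewrite -iQC; exact: isQ_iQ.
  apply: nearM => //; apply: nearV => //; apply: nearM => //; apply: near_refl => //.
  by rewrite cst_neq0// fmorph_eq0.
have h1 : hasval 1 0 by rewrite -(rmorph1 cst) -(fval1 hv); apply/hasval_cst/oner_neq0.
have Bx : B x.
  by rewrite -(dle1 B); apply/(hasval_dle (hasval_deq (near_deq hB ntx) ht) h1).
have [c ac xc] := teichmuller qx Bx.
have tc : dlt (t - cst c) 1.
  rewrite -(subrKA x); apply: dltD => //; apply: (dlt_le_trans hB) ntx _.
  exact/(hasval_dle ht h1).
(* Since i < j, the correction leaves [h] monic of degree j, hence a competitor of [gj]; [c] cancels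
   the residue of the unit [t], which makes [h] strictly smaller. *)
pose h := gj - (c * iota w) *: gi.
have sz : (size (- ((c * iota w) *: gi)) < size gj)%N.
  by rewrite size_polyN (leq_ltn_trans (size_scale_leq _ _))// si sj ltnS.
have mh : h \is monic by rewrite monicE lead_coefDl// (monicP mj).
have sh : size h = j.+1 by rewrite size_polyDl.
have ah l : appr (cst h`_l).
  have aw : appr (cst (iota w)) by rewrite -iQC; apply/appr_isQ/isQ_iQ.
  rewrite coefB coefZ rmorphB !rmorphM; apply: (subringB appr_subring) (aj l) _.
  by do 2![apply: (subringM appr_subring) => //].
have [z gz] := goodP j h mh sh ah.
have := maxj _ _ gz; rewrite leNgt => /negP; apply.
have hz : hasval h%:F (z%:~R / e%:R) by case: gz.
rewrite -(ltr_int rat) -(ltr_pM2r (_ : 0 < e%:R^-1)) ?invr_gt0//.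
apply/(hasval_dlt hz hvj).
have dn0 := hasval_neq0 hden.
have -> : h%:F = (t - cst c) * (cst (iota w) * gi%:F).
  rewrite mulrBl /t divfK// rmorphB; congr (_ - _).
  by rewrite -mul_polyC rmorphM -/(cst _) rmorphM mulrA.
apply: (dlt_le_trans hB (_ : dlt _ (1 * (cst (iota w) * gi%:F)))).
  by apply: dltM tc (dle_refl hB _) dn0.
by rewrite mul1r; apply/(hasval_dle hden hvj).
Qed.
End ResidueAlgebraic.

Definition residually_algebraic := forall x, isQ x -> B x ->
  exists P : {poly int}, (exists i, ~~ (p%:Z %| P`_i)%Z) /\ dlt (map_poly intr P).[x] 1.

Lemma pK_neq0 n : (p%:R ^+ n : K) != 0.
Proof. by rewrite expf_neq0 ?(prime_neq0 iota pp). Qed.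
Lemma val_pX n : v (p%:R ^+ n) = n%:R.
Proof. by rewrite fvalX ?(prime_neq0 iota pp)// (val_p pp vi) mulr1. Qed.

Lemma closeP n x y : close v n x y <-> dle (cst (x - y)) (cst (p%:R ^+ n)).
Proof.
rewrite dle_cst ?pK_neq0// val_pX /close /vge subr_eq0.
split=> [[->|->]|/orP[/eqP|]]; rewrite ?eqxx ?orbT//; auto.
Qed.

Lemma dle_pX m n : (n <= m)%N -> dle (cst (p%:R ^+ m)) (cst (p%:R ^+ n)).
Proof. by move=> h; rewrite dle_cst ?pK_neq0// vge_val ?pK_neq0// !val_pX ler_nat. Qed.

Lemma dle_pX_small c : c != 0 -> exists n, dle (cst (p%:R ^+ n)) (cst c).
Proof.
move=> c0; exists (Num.truncn (v c)).+1; rewrite dle_cst// vge_val ?pK_neq0// val_pX.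
by rewrite ltW// truncnS_gt.
Qed.

Lemma limit_point : (forall w : nat -> K,
      (forall n : nat, exists N, forall m k, (N <= m)%N -> (N <= k)%N -> close v n (w m) (w k)) ->
      exists l, forall n : nat, exists N, forall m, (N <= m)%N -> close v n (w m) l) ->
  residually_algebraic ->
  exists a, forall f, f != 0 -> (iP f).[a] != 0 /\ v (iP f).[a] = u f.
Proof.
move=> complete res.
have [w hw] := choice (fun n => close_points res (pK_neq0 n)).
have [n|a ha] := complete w.
  exists n => m k nm nk; apply/closeP; rewrite -lin_sub.
  apply: dleB => //; [apply: dle_trans (hw k) _|apply: dle_trans (hw m) _] => //; exact: dle_pX.
exists a => f f0; apply: near_cst_val => //; apply: near_eval_of_inf => // c c0.
have [n hn] := dle_pX_small c0; apply: (dle_trans hB) hn.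
have [N hN] := ha n.
rewrite -(subrK (lin (w (maxn n N))) (lin a)) lin_sub; apply: dleD => //.
  by apply/closeP/hN/leq_maxr.
by apply: (dle_trans hB) (hw _) _; apply/dle_pX/leq_maxl.
Qed.

(** * The residually transcendental case: an algebraic center *)

Hypothesis dense : forall (x : K) (n : nat), exists y, algebraic_over_Q y /\ close v n x y.

Lemma residually_algebraic_of_near :
  (forall f g, f != 0 -> g != 0 -> exists b,
     near (iQ f) (cst (iP f).[b]) /\ near (iQ g) (cst (iP g).[b])) -> residually_algebraic.
Proof.
move=> H x [f [g [g0 ->]]] Bx.
have [f0|f0] := eqVneq f 0.
  apply: (@algebraic_residue p K v iota pp hv M B cst hB BK dense _ 0) => //.
  by rewrite f0 !rmorph0 mul0r subrr; apply/dlt0/oner_neq0.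
have [b [hf hg]] := H f g f0 g0.
apply: (@algebraic_residue p K v iota pp hv M B cst hB BK dense _ ((iP f).[b] / (iP g).[b])) => //.
have h : near (iQ f / iQ g) (cst ((iP f).[b] / (iP g).[b])).
  by rewrite fmorph_div; apply: nearM => //; exact: nearV.
by apply: (dlt_le_trans hB) h _; rewrite dle1.
Qed.

(** For an optimal [b], a factor X - b' either has the order of X - b or is near the constant b -
    b'. The factor of [b] itself is of the first kind, whence k > 0, which allows a k-th root to be
    taken when finding the value of X - b. *)
Lemma prod_lin_deq b (s : seq K) : (forall b', dle (lin b) (lin b')) ->
  exists k c, [/\ c != 0, deq (\prod_(b' <- s) lin b') (cst c * lin b ^+ k) & b \in s -> (0 < k)%N].
Proof.
move=> hb; elim: s => [|b' s [k [c [c0 hk ks]]]].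
  by exists 0%N, 1; rewrite oner_neq0 big_nil rmorph1 expr0 mulr1; split=> //; exact: deq_refl.
have [le|lt] := dle_or_lt B (lin b') (lin b).
  exists k.+1, c; split=> //; rewrite big_cons exprS mulrCA; apply: deqM => //.
have nb : near (lin b') (cst (b - b')).
  by rewrite /near -lin_sub opprB addrC subrK.
have bb' : b - b' != 0 by have := near_neq0 hB (near_sym hB nb); rewrite fmorph_eq0.
exists k, ((b - b') * c); rewrite mulf_neq0//; split=> //.
  by rewrite big_cons rmorphM -mulrA; apply: deqM => //; exact: near_deq.
rewrite inE => /orP[/eqP e'|/ks//].
by rewrite e' subrr eqxx in bb'.
Qed.

Lemma algebraic_center : ~ residually_algebraic ->
  exists b d, algebraic_over_Q b /\ forall f, f != 0 -> monov v b d (iP f) = u f.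
Proof.
move=> nres.
have [b0 hb0] : exists b0, forall b, dle (lin b0) (lin b).
  apply: contrapT => H; apply: nres; apply: residually_algebraic_of_near => f g f0 g0.
  apply: near_eval_pair => // b; apply: contrapT => Hb; apply: H; exists b => b'.
  by have [//|lt] := dle_or_lt B (lin b) (lin b'); case: Hb; exists b'.
(* If X were infinitely close to [b0], each f(X) would be near f(b0) and all residues would be
   algebraic. The constant [c] leaves room to move [b0] to an algebraic element while staying
   optimal. *)
have [c [c0 hc]] : exists c, c != 0 /\ dlt (cst c) (lin b0).
  apply: contrapT => H; apply: nres; apply: residually_algebraic_of_near => f g f0 g0.
  have inf c : c != 0 -> dle (lin b0) (cst c).
    by move=> c0; have [//|lt] := dle_or_lt B (lin b0) (cst c); case: H; exists c.
  by exists b0; split; apply: near_eval_of_inf.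
have [n hn] := dle_pX_small c0.
have [b [[P [P0 rootP]] bb0]] := dense b0 n.
have lb : dle (lin b) (lin b0).
  rewrite -(subrK (lin b0) (lin b)) lin_sub; apply: dleD => //.
  move/closeP: bb0 => h; apply: (dle_trans hB) h _; apply: (dle_trans hB) hn _; exact: dltW.
have hb b' : dle (lin b) (lin b') by apply: (dle_trans hB) lb (hb0 _).
have rootP' : root (iP P) b.
  by move: rootP; rewrite (eq_map_poly (_ : ratr =1 iota))// => q; rewrite fmorph_eq_rat.
(* That X - b has a value at all comes from [b] being algebraic: P(X) lies in Q(X), so it has a
   value, and it has the order of a constant times a positive power of X - b. *)
have [d hd] : exists d, hasval (lin b) d.
  have iP0 : iP P != 0 by rewrite map_poly_eq0.
  have [s E Es] := factor_poly iP0.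
  have [k [c' [c'0 hk k0]]] := prod_lin_deq s hb.
  have lc0 : lead_coef (iP P) != 0 by rewrite lead_coef_eq0.
  have h : hasval (cst (lead_coef (iP P) * c') * lin b ^+ k) (u P).
    apply: hasval_deq (hasval_iQ P0).
    by rewrite /iQ {1}E prodF rmorphM -mulrA; apply: deqM => //; exact: deq_refl.
  have h' := hasvalM (hasvalV (hasval_cst (mulf_neq0 lc0 c'0))) h.
  rewrite mulKf ?cst_neq0 ?mulf_neq0// in h'.
  by exists ((- v (lead_coef (iP P) * c') + u P) / k%:R); apply: hasvalX_inv h'; apply: k0; rewrite -Es.
(* A tie between [d] and v(b - b') is harmless, since X - b' is never smaller than X - b. *)
have hl b' : hasval (lin b') (mindist v b d b').
  rewrite /mindist; case: eqVneq => [->//|nb].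
  have bb' : b - b' != 0 by rewrite subr_eq0 eq_sym.
  rewrite /Order.min; case: ifP => [lt|/negbT].
    apply: (hasval_deq _ hd); split; first exact: hb.
    rewrite -(subrK (lin b) (lin b')) lin_sub.
    apply: dleD => //.
    by apply/(hasval_dle (hasval_cst bb') hd)/ltW.
  rewrite -leNgt le_eqVlt => /orP[/eqP e'|lt].
    rewrite e'; apply: (hasval_deq _ hd); split; first exact: hb.
    rewrite -(subrK (lin b) (lin b')) lin_sub.
    apply: dleD => //.
    by apply/(hasval_dle (hasval_cst bb') hd); rewrite e'.
  apply: hasval_deq (hasval_cst bb'); apply: near_deq => //.
  have E : cst (b - b') - lin b' = - lin b by rewrite -lin_sub addrAC subrr sub0r.
  by rewrite /near E; apply: dltN => //; apply/(hasval_dlt hd (hasval_cst bb')).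
exists b, d; split; first by exists P.
move=> f f0; have iP0 : iP f != 0 by rewrite map_poly_eq0.
have [s E _] := factor_poly iP0; apply: hasval_inj _ (hasval_iQ f0).
rewrite /iQ E monov_prod ?lead_coef_eq0// prodF; apply: hasvalM.
  by apply: hasval_cst; rewrite lead_coef_eq0.
elim: (s) => [|b' t IH]; last by rewrite !big_cons; exact: hasvalM.
by rewrite !big_nil -(rmorph1 cst) -(fval1 hv); apply/hasval_cst/oner_neq0.
Qed.
End Approximation.

(** * Discrete valuation rings of Q(X) *)

Lemma ratr_morphism (F : fieldType) : [pchar F] =i pred0 -> exists _ : {rmorphism rat -> F}, True.
Proof.
move=> /pcharf0P char0.
have nz (z : int) : z != 0 -> z%:~R != 0 :> F.
  case: z => n; first by rewrite eqz_nat -char0.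
  by move=> _; rewrite NegzE rmorphN oppr_eq0 /= char0.
have nzd x : (denq x)%:~R != 0 :> F by rewrite nz ?denq_neq0.
have dz x : (denq x)%:~R != 0 :> rat by rewrite intr_eq0 denq_neq0.
(* In characteristic 0, [ratr] can be computed from any fraction representing [x], not only the
   reduced one; both morphism laws follow. *)
have char : forall (x : rat) (a b : int), b != 0 -> x = a%:~R / b%:~R ->
    ratr x = a%:~R / b%:~R :> F.
  move=> x a b b0 E; rewrite /ratr; apply/eqP; rewrite eqr_div ?nz// -!rmorphM /=.
  apply/eqP; congr (_%:~R); apply: (@intr_inj rat); rewrite !rmorphM /=.
  have b0' : b%:~R != 0 :> rat by rewrite intr_eq0.
  apply/eqP; rewrite -eqr_div// -E divq_num_den eqxx//.
have add : zmod_morphism (@ratr F).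
  move=> x y; rewrite (@char (x - y) (numq x * denq y - numq y * denq x) (denq x * denq y)).
  - by rewrite rmorphB !rmorphM /= -fracB.
  - by rewrite mulf_neq0 ?denq_neq0.
  - by rewrite rmorphB !rmorphM /= -fracB// !divq_num_den.
have mul : monoid_morphism (@ratr F).
  split; first by rewrite (ratr_int F 1).
  move=> x y; rewrite (@char (x * y) (numq x * numq y) (denq x * denq y)).
  - by rewrite !rmorphM /= -mulf_div.
  - by rewrite mulf_neq0 ?denq_neq0.
  - by rewrite !rmorphM /= -mulf_div !divq_num_den.
pose fa := GRing.isZmodMorphism.Build _ _ (@ratr F) add.
pose fm := GRing.isMonoidMorphism.Build _ _ (@ratr F) mul.
pose f : {rmorphism rat -> F} := HB.pack (@ratr F) fa fm.
by exists f.
Qed.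

Lemma Cp_model_val p (K : closedFieldType) (v : K -> rat) : Cp_model p v -> is_val v.
Proof. by case=> _ h1 h2 _ _ _; split. Qed.

Lemma Cp_model_iota p (K : closedFieldType) (v : K -> rat) : Cp_model p v ->
  exists iota : {rmorphism rat -> K}, forall q, q != 0 -> v (iota q) = vp p q.
Proof.
case=> h0 _ _ h3 _ _; have [iota _] := ratr_morphism h0; exists iota => q q0.
by rewrite fmorph_eq_rat h3.
Qed.

Lemma vp_ge0 p (q : rat) : prime p -> q != 0 -> (0 <= vp p q) = ~~ (p %| `|denq q|)%N.
Proof.
move=> pp q0; rewrite /vp -[0]/(0%:~R) ler_int subr_ge0 lez_nat.
have d0 : (0 < `|denq q|)%N by rewrite absz_gt0 denq_neq0.
have n0 : (0 < `|numq q|)%N by rewrite absz_gt0 numq_eq0.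
have [pd|npd] := boolP (p %| `|denq q|)%N; last by rewrite (lognE p `|denq q|) (negPf npd) !andbF.
have -> : logn p `|numq q| = 0%N.
  rewrite lognE n0 pp /=; case: ifP => // pn.
  have : (p %| gcdn `|numq q| `|denq q|)%N by rewrite dvdn_gcd pn.
  by have := coprime_num_den q; rewrite /coprime => /eqP ->; rewrite dvdn1 => /eqP p1; rewrite p1 in pp.
by rewrite leqn0 (lognE p `|denq q|) d0 pp pd.
Qed.

Section ExponentZ.
Variables (F : fieldType) (v : F -> rat).
Hypothesis hv : is_val v.
Lemma fval_exprz x (z : int) : x != 0 -> v (x ^ z) = z%:~R * v x.
Proof.
move=> x0; case: z => n; first by rewrite -exprnP fvalX.
by rewrite NegzE -exprnN fvalV ?expf_neq0// fvalX// rmorphN mulNr.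
Qed.
(** The integers N v(x) form a subgroup gZ, with g the least positive one: a nonzero remainder
    modulo g would be the value of x divided by a power of [y], and smaller than g. Dividing by g
    gives the surjectivity on Z that [isDVR] asks for. *)
Lemma normalize_discrete N : (0 < N)%N ->
  (forall x, x != 0 -> exists z : int, N%:R * v x = z%:~R) ->
  (exists2 x, x != 0 & 0 < v x) ->
  exists w : F -> int, exists c, [/\ 0 < c, forall x, x != 0 -> (w x)%:~R = c * v x &
    exists y, y != 0 /\ w y = 1].
Proof.
move=> N0 vN [x1 x10 v1].
have NR : (0 : rat) < N%:R by rewrite ltr0n.
pose w0 x := Num.floor (N%:R * v x).
have w0E x : x != 0 -> (w0 x)%:~R = N%:R * v x.
  by move=> /vN[z E]; rewrite /w0 E intrKfloor.
have pos : exists n : nat, (0 < n)%N && `[< exists2 x, x != 0 & w0 x = n%:Z >].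
  have w1 : 0 < w0 x1 by rewrite -(ltr_int rat) w0E// mulr_gt0.
  exists `|w0 x1|%N; rewrite absz_gt0 (lt0r_neq0 w1); apply/asboolP; exists x1 => //.
  by rewrite gez0_abs// ltW.
case: (ex_minnP pos) => g /andP[g0 /asboolP[y y0 wy]] gmin.
have gz : g%:Z != 0 by rewrite eqz_nat -lt0n.
have dvd x : x != 0 -> exists k : int, w0 x = k * g%:Z.
  move=> x0; have mod0 : (w0 x %% g%:Z)%Z = 0.
    apply/eqP; apply: contraT => r0; exfalso.
    have r_ge0 := modz_ge0 (w0 x) gz.
    have := gmin `|(w0 x %% g%:Z)%Z|%N; rewrite absz_gt0 r0 /= => H.
    have : (g <= `|(w0 x %% g%:Z)%Z|)%N.
      apply: H; apply/asboolP; exists (x / y ^ (w0 x %/ g%:Z)%Z).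
        by rewrite mulf_neq0 ?invr_eq0 ?expfz_neq0.
      rewrite gez0_abs//; apply: (@intr_inj rat).
      rewrite w0E ?mulf_neq0 ?invr_eq0 ?expfz_neq0// val_div ?expfz_neq0// fval_exprz//.
      by rewrite mulrBr mulrCA -!w0E// wy -rmorphM -rmorphB.
    by rewrite -lez_nat gez0_abs// leNgt ltz_pmod// ltz_nat.
  by exists (w0 x %/ g%:Z)%Z; rewrite {1}(divz_eq (w0 x) g%:Z) mod0 addr0.
exists (fun x => (w0 x %/ g%:Z)%Z), (N%:R / g%:R); split.
- by rewrite divr_gt0// ltr0n.
- move=> x x0; rewrite mulrAC -w0E//; have [k Ek] := dvd x x0.
  by rewrite Ek mulzK// rmorphM /= mulfK// intr_eq0.
- by exists y; split=> //; rewrite wy divzz gz.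
Qed.
End ExponentZ.

(** A common form for abstract discrete valuation rings and for both kinds of [Zpad], so that rings
    are compared through valuations of Q[X]. *)
Definition poly_valring (u : {poly rat} -> rat) (phi : QX) : Prop :=
  exists f g, [/\ g != 0, phi = QXof f / QXof g & f = 0 \/ u g <= u f].

Lemma QXof_eq0 f : (QXof f == 0) = (f == 0).
Proof. exact: tofrac_eq0. Qed.

Lemma QX_frac (phi : QX) : exists f g, g != 0 /\ phi = QXof f / QXof g.
Proof.
have d0 : \d_(repr phi) != 0 by exact: denom_ratioP.
exists \n_(repr phi), \d_(repr phi); split=> //.
apply: (mulIf (x := QXof \d_(repr phi))); rewrite ?QXof_eq0// divfK ?QXof_eq0//.
rewrite -{1}[phi]reprK /QXof; unlock FracField.tofrac.
rewrite -[LHS]FracField.pi_mul; apply/eqmodP; rewrite /= FracField.equivfE /FracField.mulf.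
by rewrite !numden_Ratio ?mulr1 ?oner_neq0// mulrC.
Qed.

Lemma QX_frac_eq f g f' g' : g != 0 -> g' != 0 ->
  QXof f / QXof g = QXof f' / QXof g' -> f * g' = f' * g.
Proof.
move=> g0 g'0 /eqP; rewrite eqr_div ?QXof_eq0// -!tofracM tofrac_eq => /eqP ->.
by [].
Qed.

Lemma poly_valring_frac u f g : is_val u -> f != 0 -> g != 0 ->
  poly_valring u (QXof f / QXof g) <-> u g <= u f.
Proof.
move=> hu f0 g0; split=> [[f' [g' [g'0 E h]]]|h]; last by exists f, g; split=> //; right.
have := QX_frac_eq g0 g'0 E => Efg.
have f'0 : f' != 0.
  by apply: contraTneq (mulf_neq0 f0 g'0) => f'0; rewrite Efg f'0 mul0r eqxx.
case: h => [e|h]; first by rewrite e eqxx in f'0.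
by have := congr1 u Efg; rewrite !fvalM//; lra.
Qed.

Lemma poly_valring0 u : poly_valring u 0.
Proof. by exists 0, 1; rewrite oner_neq0 /QXof rmorph0 mul0r; split=> //; left. Qed.

Lemma poly_valring_ext u u' phi : (forall f, f != 0 -> u f = u' f) -> poly_valring u phi -> poly_valring u' phi.
Proof.
move=> E [f [g [g0 -> h]]]; exists f, g; split=> //.
have [->|f0] := eqVneq f 0; first by left.
by right; case: h => [e|]; [rewrite e eqxx in f0 | rewrite !E].
Qed.

Lemma maxideal_poly_valring u (W : QX -> Prop) f g : is_val u -> (forall phi, W phi <-> poly_valring u phi) ->
  f != 0 -> g != 0 -> maxideal W (QXof f / QXof g) <-> u g < u f.
Proof.
move=> hu hW f0 g0; rewrite /maxideal invf_div !hW !poly_valring_frac//.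
split=> [[h1 [/eqP|h2]]|h].
- by rewrite mulf_eq0 invr_eq0 !QXof_eq0 (negPf f0) (negPf g0).
- by rewrite ltNge; apply/negP.
- by split; [exact: ltW | right; apply/negP; rewrite -ltNge].
Qed.

Section DiscreteValuation.
Variables (p : nat) (u : {poly rat} -> rat) (W : QX -> Prop).
Hypotheses (pp : prime p) (hu : is_val u) (uC : forall q, q != 0 -> u q%:P = vp p q).
Hypothesis hW : forall phi, W phi <-> poly_valring u phi.

Lemma lies_over_poly_valring : lies_over_Zp p W.
Proof.
move=> q; rewrite hW /Defs.inZp; have [->|q0] := eqVneq q 0.
  rewrite /QXconst polyC0 /QXof rmorph0 (_ : denq 0 = 1)//; split=> _; last exact: poly_valring0.
  by rewrite absz1 dvdn1; apply: contraTneq pp => ->.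
have -> : QXconst q = QXof q%:P / QXof 1 by rewrite /QXof rmorph1 divr1.
by rewrite poly_valring_frac ?polyC_eq0 ?oner_neq0// fval1// uC// vp_ge0.
Qed.

Lemma frac_val : exists2 m : QX -> rat, is_val m &
  forall f g, f != 0 -> g != 0 -> m (QXof f / QXof g) = u f - u g.
Proof.
have [fg hfg] := choice (fun phi => let: ex_intro f (ex_intro g h) := QX_frac phi in
  ex_intro (fun fg : {poly rat} * {poly rat} => fg.2 != 0 /\ phi = QXof fg.1 / QXof fg.2) (f, g) h).
pose m phi := u (fg phi).1 - u (fg phi).2.
have mE f g : f != 0 -> g != 0 -> m (QXof f / QXof g) = u f - u g.
  move=> f0 g0; rewrite /m; have [d0 E] := hfg (QXof f / QXof g).
  move: (fg _).1 (fg _).2 d0 E => f' g' g'0 E'.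
  have E := QX_frac_eq g0 g'0 E'; have f'0 : f' != 0.
    by apply: contraTneq (mulf_neq0 f0 g'0) => f'0; rewrite E f'0 mul0r eqxx.
  by have := congr1 u E; rewrite !fvalM//; lra.
exists m => //.
have P x : x != 0 -> exists f g, [/\ f != 0, g != 0 & x = QXof f / QXof g].
  move=> x0; have [f [g [g0 E]]] := QX_frac x; exists f, g; split=> //.
  by apply: contraNneq x0 => f0; rewrite E f0 /QXof rmorph0 mul0r.
split=> x y /P[f [g [f0 g0 ->]]] /P[f' [g' [f'0 g'0 ->]]].
  rewrite mulf_div -!tofracM !mE ?mulf_neq0// !fvalM//; ring.
rewrite addf_div ?QXof_eq0// -!tofracM -tofracD => h.
have s0 : f * g' + f' * g != 0.
  by apply: contraNneq h => ->; rewrite rmorph0 mul0r.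
rewrite !mE ?mulf_neq0// !fvalM//.
have := hu.2 _ _ (mulf_neq0 f0 g'0) (mulf_neq0 f'0 g0) s0; rewrite !fvalM//.
by rewrite !ge_min => /orP[h'|h']; apply/orP; [left|right]; lra.
Qed.

Lemma isDVR_poly_valring (N : nat) : (0 < N)%N ->
  (forall f, f != 0 -> exists z : int, N%:R * u f = z%:~R) -> isDVR W.
Proof.
move=> N0 uN; have [m hm mE] := frac_val.
have P x : x != 0 -> exists f g, [/\ f != 0, g != 0 & x = QXof f / QXof g].
  move=> x0; have [f [g [g0 E]]] := QX_frac x; exists f, g; split=> //.
  by apply: contraNneq x0 => f0; rewrite E f0 /QXof rmorph0 mul0r.
have mN x : x != 0 -> exists z : int, N%:R * m x = z%:~R.
  move=> /P[f [g [f0 g0 ->]]]; have [z1 E1] := uN f f0; have [z2 E2] := uN g g0.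
  by exists (z1 - z2); rewrite mE// mulrBr E1 E2 rmorphB.
have [|w [c [c0 wE w1]]] := normalize_discrete hm N0 mN.
  exists (QXof p%:R%:P / QXof 1).
    by rewrite mulf_neq0 ?invr_eq0 ?QXof_eq0 ?polyC_eq0 ?oner_neq0 ?rat_prime_neq0.
  rewrite mE ?polyC_eq0 ?oner_neq0 ?rat_prime_neq0// fval1//.
  by rewrite uC ?rat_prime_neq0// vp_prime// subr0 ltr01.
exists w; split; [|split; [|split]].
- move=> x y' x0 y'0; apply: (@intr_inj rat); rewrite intrD.
  by rewrite (wE _ (mulf_neq0 x0 y'0)) (wE _ x0) (wE _ y'0) (fvalM hm x0 y'0) mulrDr.
- move=> x y' x0 y'0 s0; have := hm.2 _ _ x0 y'0 s0; rewrite !ge_min -!(ler_int rat).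
  by rewrite (wE _ x0) (wE _ y'0) (wE _ s0) !ler_pM2l.
- by [].
- move=> x; rewrite hW; have [->|x0] := eqVneq x 0; first by split=> _; [left | exact: poly_valring0].
  have [f [g' [f0 g'0 E]]] := P x x0.
  have -> : (0 <= w x) = (u g' <= u f).
    by rewrite -(ler_int rat) wE// E mE// pmulr_rge0// subr_ge0.
  rewrite {1}E poly_valring_frac//; split=> [h|[e|//]]; first by right.
  by rewrite e eqxx in x0.
Qed.
End DiscreteValuation.

(** * Value groups *)

Lemma sum0_equal_vals (F : idomainType) (v : F -> rat) (I : finType) (G : I -> F) : is_val v ->
  \sum_i G i = 0 -> (exists i, G i != 0) ->
  exists i j, [/\ i != j, G i != 0, G j != 0 & v (G i) = v (G j)].
Proof.
move=> hv S0 [k0 Gk0].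
pose k := [arg min_(k < k0 | G k != 0) v (G k)]%O.
have [Gk mk] : G k != 0 /\ forall i, G i != 0 -> v (G k) <= v (G i).
  by rewrite /k; case: arg_minP.
apply: contrapT => H.
have [] : \sum_i G i != 0 /\ v (\sum_i G i) = v (G k).
  apply: val_perturb => //; rewrite (bigD1 k)//= addrAC subrr add0r.
  apply: vgt_sum => // i ik; rewrite /vgt; case: eqVneq => //= Gi.
  rewrite lt_def mk// andbT; apply/eqP => e; apply: H; exists i, k; split=> //.
by rewrite S0 eqxx.
Qed.

Section ValueGroups.
Variables (p : nat) (K : closedFieldType) (v : K -> rat) (iota : {rmorphism rat -> K}).
Hypotheses (pp : prime p) (hv : is_val v).
Hypothesis vi : forall q, q != 0 -> v (iota q) = vp p q.

Local Notation iP := (map_poly iota).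

Lemma ratr_iota : ratr =1 iota.
Proof. by move=> q; rewrite fmorph_eq_rat. Qed.
Lemma map_ratr f : map_poly ratr f = iP f.
Proof. exact/eq_map_poly/ratr_iota. Qed.

(** Discreteness of the values on Q[b] only; approximating coefficients extends it to Q_p(b). *)
Definition discrete_at (b : K) := exists2 N : nat, (0 < N)%N &
  forall h, (iP h).[b] != 0 -> exists z : int, N%:R * v (iP h).[b] = z%:~R.

(** The powers y^0, ..., y^n lie in a rational space of dimension at most n, so they are linearly
    dependent, and two terms of a vanishing combination have equal values. Thus (j - i) v(y) is an
    integer for some 0 < j - i <= n, and j - i divides n!. *)
Lemma discrete_at_algebraic b : algebraic_over_Q b -> discrete_at b.
Proof.
move=> [P [P0]]; rewrite map_ratr => rootP.
pose n := size P; exists n`!; first exact: fact_gt0.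
move=> h; set y := (iP h).[b] => y0.
pose A : 'M[rat]_(n.+1, n) := \matrix_(i < n.+1) poly_rV (h ^+ i %% P).
have [c c0 Ec] : exists2 c : 'rV[rat]_n.+1, c != 0 & c *m A = 0.
  have : kermx A != 0.
    by rewrite kermx_eq0 /row_free neq_ltn (leq_ltn_trans (rank_leq_col _))// ltnSn.
  by case/rowV0Pn => c /sub_kermxP Ec c0; exists c.
have powE i : y ^+ i = (iP (h ^+ i %% P)).[b].
  rewrite /y -horner_exp -rmorphXn {1}(divp_eq (h ^+ i) P) rmorphD rmorphM /= !hornerE.
  by rewrite (eqP rootP) mulr0 add0r.
have S0 : \sum_(i < n.+1) iota (c 0 i) * y ^+ i = 0.
  have E : \sum_(i < n.+1) c 0 i *: (h ^+ i %% P) = 0.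
    have sz i : (size (h ^+ i %% P)%R <= n)%N by rewrite ltnW ?ltn_modp.
    rewrite -[RHS](linear0 (@rVpoly rat n)) -Ec mulmx_sum_row linear_sum; apply: eq_bigr => i _.
    by rewrite linearZ /= rowK poly_rV_K.
  have := congr1 (fun g => (iP g).[b]) E; rewrite rmorph0 horner0 rmorph_sum horner_sum => E'.
  rewrite -[RHS]E'.
  by apply: eq_bigr => i _; rewrite powE /= map_polyZ hornerZ.
have [k ck] : exists k, c 0 k != 0.
  apply/existsP; apply: contra_neqT c0 => /existsPn H; apply/rowP => k.
  by rewrite mxE; apply/eqP; have := H k; rewrite negbK.
have [|i [j [ij]]] := sum0_equal_vals hv S0.
  by exists k; rewrite mulf_neq0 ?fmorph_eq0 ?expf_neq0.
rewrite !mulf_eq0 !negb_or !fmorph_eq0 => /andP[ci yi] /andP[cj yj].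
rewrite !fvalM ?fmorph_eq0// !fvalX// !vi//.
wlog lt : i j ij ci cj {yi yj} / (i < j)%N.
  move=> H E; have [|ji|/val_inj e] := ltngtP i j; first by move=> l; apply: (H i j).
    by apply: (H j i) => //; rewrite eq_sym.
  by rewrite e eqxx in ij.
rewrite /vp; move: (_ - _) (_ - _) => z2 z1 E.
have /dvdnP[q Eq] : (j - i %| n`!)%N.
  apply: dvdn_fact; rewrite subn_gt0 lt /=.
  by rewrite leq_subLR (leq_trans _ (leq_addl _ _))// -ltnS.
exists (q%:Z * (z1 - z2)); rewrite Eq natrM natrB 1?ltnW// rmorphM rmorphB /= -mulrA.
by congr (_ * _); rewrite mulrBl; lra.
Qed.

Lemma monov_discrete b d : discrete_at b -> exists2 N : nat, (0 < N)%N &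
  forall f, f != 0 -> exists z : int, N%:R * monov v b d (iP f) = z%:~R.
Proof.
move=> [N N0 hN]; exists (N * `|denq d|)%N; first by rewrite muln_gt0 N0 absz_gt0 denq_neq0.
(* This is Q[b], which contains all the coefficients of f(X + b). *)
pose A y := exists h, y = (iP h).[b].
have sA : subring A.
  split=> [|_ _ [g ->] [h ->]|_ _ [g ->] [h ->]].
  - by exists 1; rewrite rmorph1 hornerC.
  - by exists (g - h); rewrite rmorphB hornerD hornerN.
  - by exists (g * h); rewrite rmorphM hornerM.
have sP : subring (coefs_in A).
  split; first by rewrite -polyC1; apply: coefs_inC => //; exact: subring1.
    by move=> g h; exact: coefs_inB.
  by move=> g h; exact: coefs_inM.
move=> f f0; have hf : coefs_in A (iP f \Po ('X + b%:P)).
  rewrite comp_polyE; apply: (subring_sum sP) => i _; apply: (coefs_inZ sA).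
    by exists (f`_i)%:P; rewrite map_polyC hornerC coef_map.
  apply: (subringX sP); apply: (coefs_inD sA); first exact: coefs_inX.
  by apply: (coefs_inC sA); exists 'X; rewrite map_polyX hornerX.
have iP0 : iP f != 0 by rewrite map_poly_eq0.
rewrite monovE; have [i ci <-] := gaussv_attained v d (comp_XaddC_neq0 b iP0).
have [h Eh] := hf i; have [|z Ez] := hN h; first by rewrite -Eh.
exists (z * denq d + N%:Z * i%:Z * numq d).
have dE : (denq d)%:~R * d = (numq d)%:~R by rewrite mulrC -{1}(divq_num_den d) divfK ?intr_eq0 ?denq_neq0.
rewrite natrM [`|_|%N%:R](_ : _ = (denq d)%:~R); last by rewrite -[LHS]/(`|denq d|%N%:Z%:~R) absz_denq.
rewrite rmorphD !rmorphM /= -Ez -Eh -dE -!pmulrn; ring.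
Qed.

Lemma inQp_iota q : inQp v (iota q).
Proof. by move=> n; exists q; left; rewrite ratr_iota. Qed.

Lemma polyQp_iota f : polyQp v (iP f).
Proof. by move=> i; rewrite coef_map; exact: inQp_iota. Qed.

Lemma algebraic_over_Qp_of_Q b : algebraic_over_Q b -> algebraic_over_Qp v b.
Proof.
move=> [P [P0]]; rewrite map_ratr => rootP; exists (iP P); split; rewrite ?map_poly_eq0//.
by split=> //; exact: polyQp_iota.
Qed.

Lemma polyQp_approx (P : {poly K}) a : polyQp v P -> P.[a] != 0 ->
  exists h, (iP h).[a] != 0 /\ v (iP h).[a] = v P.[a].
Proof.
(* This precision makes each error term (P_i - q_i) a^i of value greater than v(P(a)), even for
   negative v(a). The case a = 0, where v(a) is junk, is treated apart. *)
move=> hP Pa; pose n := (Num.truncn (`|v P.[a]| + (size P)%:R * `|v a|)).+1.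
have hn : v P.[a] + (size P)%:R * `|v a| < n%:R.
  by apply: le_lt_trans (truncnS_gt _); rewrite lerD2r ler_norm.
have [q hq] := choice (fun i => hP i n).
exists (\poly_(i < size P) q i); apply: val_perturb => //.
rewrite (horner_coef_wide _ (_ : size (iP _) <= size P)%N); last first.
  by rewrite size_map_poly size_poly.
rewrite [X in _ - X]horner_coef -sumrB; apply: vgt_sum => // i _; rewrite -mulrBl coef_map coef_poly ltn_ord.
have hq' : vge v n%:R (P`_i - iota (q i)).
  by rewrite -ratr_iota /vge subr_eq0; case: (hq i) => [->|->]; rewrite ?eqxx ?orbT.
rewrite -opprB mulNr vgtN//.
have hn0 : v P.[a] < n%:R by apply: le_lt_trans hn; rewrite lerDl mulr_ge0.
have [a0|a0] := eqVneq a 0.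
  have [i0|i0] := eqVneq (i : nat) 0%N; last by rewrite a0 expr0n (negPf i0) mulr0 vgt0.
  by move: hq'; rewrite i0 expr0 mulr1; exact: vge_gt hn0.
apply: (@vge_gt _ _ (n%:R + i%:R * v a)).
  have le : - ((size P)%:R * `|v a|) <= i%:R * v a.
    apply: (@le_trans _ _ (- (i%:R * `|v a|))).
      by rewrite lerN2 ler_wpM2r// ler_nat ltnW.
    by rewrite -mulrN ler_wpM2l// lerNl -normrN ler_norm.
  by lra.
by apply: vgeM => //; rewrite -fvalX//; exact: vge_refl.
Qed.

Lemma discrete_in_Cpbr a : discrete_at a -> in_Cpbr v a.
Proof.
move=> [N N0 hN]; exists N; split=> // r [y [[P [Q [hP [hQ [Qa Ey]]]]] [y0 <-]]].
have Pa : P.[a] != 0 by apply: contraNneq y0 => Pa; rewrite Ey Pa mul0r.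
have [g [g0 vg]] := polyQp_approx hP Pa; have [h [h0 vh]] := polyQp_approx hQ Qa.
have [z1 E1] := hN g g0; have [z2 E2] := hN h h0.
by rewrite Ey val_div// -vg -vh mulrBr E1 E2 -rmorphB intr_int.
Qed.

Lemma in_Cpbr_discrete a : in_Cpbr v a -> discrete_at a.
Proof.
move=> [N [N0 hN]]; exists N => // h h0; apply/intrP/hN.
exists (iP h).[a]; split=> //; exists (iP h), 1; split; first exact: polyQp_iota.
split; last by rewrite !hornerE oner_neq0 divr1.
by rewrite -(rmorph1 iP); exact: polyQp_iota.
Qed.

End ValueGroups.

(** * Properties of the rings attached to pairs *)

(** Stated for a relation because sending f/g to f(a)/g(a) is used as a relation between Q(X) and
    [K], without building a morphism. *)
Lemma horner_int_rel (F G : comNzRingType) (ev : F -> G -> Prop) x y (P : {poly int}) :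
  (forall a b c d, ev a b -> ev c d -> ev (a + c) (b + d)) ->
  (forall a b c d, ev a b -> ev c d -> ev (a * c) (b * d)) ->
  (forall z : int, ev z%:~R z%:~R) -> ev x y -> ev (map_poly intr P).[x] (map_poly intr P).[y].
Proof.
move=> evD evM evZ exy; elim/poly_ind: P => [|P z IH].
  by rewrite !rmorph0 !horner0 -[0]/(0%:~R) -[X in ev _ X]/(0%:~R).
rewrite !rmorphD !rmorphM /= !map_polyX !map_polyC /= !hornerD !hornerM !hornerX !hornerC.
by apply: evD => //; apply: evM.
Qed.

Lemma horner_int_morph (R F : comNzRingType) (T : {rmorphism {poly R} -> F}) g (P : {poly int}) :
  (map_poly intr P).[T g] = T (map_poly intr P \Po g).
Proof.
elim/poly_ind: P => [|Q z IH]; first by rewrite !rmorph0 horner0 ?comp_poly0 ?rmorph0.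
have E (S : comNzRingType) :
    map_poly intr (Q * 'X + z%:P) = map_poly intr Q * 'X + (z%:~R)%:P :> {poly S}.
  by rewrite rmorphD rmorphM /= map_polyX map_polyC.
rewrite !E hornerD hornerM hornerX hornerC IH.
rewrite comp_polyD comp_polyM comp_polyX comp_polyC rmorphD rmorphM.
by rewrite (rmorph_int (@polyC R)) rmorph_int.
Qed.

Section Extensions.
Variables (p : nat) (K : closedFieldType) (v : K -> rat) (iota : {rmorphism rat -> K}).
Hypotheses (pp : prime p) (hv : is_val v).
Hypothesis vi : forall q, q != 0 -> v (iota q) = vp p q.

Local Notation iP := (map_poly iota).

Definition mval a d (f : {poly rat}) := monov v a d (iP f).
Definition eval_val a (f : {poly rat}) := v (iP f).[a].

Lemma transcendental_eval a : transcendental_over_Q a -> forall f, f != 0 -> (iP f).[a] != 0.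
Proof.
by move=> ta f f0; apply: contra_notN ta => /eqP fa; exists f; rewrite (map_ratr iota) /root fa.
Qed.

Lemma transcendental_of_eval a : (forall f, f != 0 -> (iP f).[a] != 0) -> transcendental_over_Q a.
Proof. by move=> h [f [f0]]; rewrite (map_ratr iota) /root; apply/negP/h. Qed.

Lemma mval_val a d : is_val (mval a d).
Proof. exact: (@is_val_shift _ _ (monov_val hv a d) _ iP (map_poly_inj iota)). Qed.

Lemma eval_val_val a : transcendental_over_Q a -> is_val (eval_val a).
Proof.
move=> /transcendental_eval ta; split=> f g f0 g0; rewrite /eval_val.
  by rewrite rmorphM hornerM fvalM// ta.
move=> s0; rewrite rmorphD hornerD; apply: hv.2; rewrite ?ta//.
by rewrite -hornerD -rmorphD ta.
Qed.

Lemma mvalC a d q : q != 0 -> mval a d q%:P = vp p q.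
Proof. by move=> q0; rewrite /mval map_polyC monovC// vi. Qed.

Lemma eval_valC a q : q != 0 -> eval_val a q%:P = vp p q.
Proof. by move=> q0; rewrite /eval_val map_polyC hornerC vi. Qed.

Lemma Zpad_Some a d phi : Zpad v a (Some d) phi <-> poly_valring (mval a d) phi.
Proof.
by split=> [[f [g]]|[f [g]]]; rewrite /= ?(map_ratr iota) => h; exists f, g;
  rewrite ?(map_ratr iota); case: h => // ? [].
Qed.

Lemma Zpad_None a phi : transcendental_over_Q a -> Zpad v a None phi <-> poly_valring (eval_val a) phi.
Proof.
move=> /transcendental_eval ta.
split=> [[f [g]]|[f [g [g0 E h]]]].
  rewrite !(map_ratr iota) => -[ga [E h]]; exists f, g; split=> //.
    by apply: contraNneq ga => ->; rewrite rmorph0 horner0.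
  case: h => [fa|]; last by right.
  by left; apply/eqP/(contraTT (ta f)); rewrite fa eqxx.
exists f, g; rewrite !(map_ratr iota); split; first exact: ta.
split=> //; case: h => [->|]; last by right.
by left; rewrite rmorph0 horner0.
Qed.

Lemma poly_valring_X u : is_val u -> poly_valring u QX_X <-> 0 <= u 'X.
Proof.
move=> hu; have -> : QX_X = QXof 'X / QXof 1 by rewrite /QXof rmorph1 divr1.
by rewrite poly_valring_frac ?polyX_eq0 ?oner_neq0// fval1.
Qed.

Lemma X_in_Some a d : poly_valring (mval a d) QX_X <-> in_Op v a /\ 0 <= d.
Proof.
rewrite (poly_valring_X (mval_val a d)) /mval map_polyX.
have -> : 'X = 'X - 0%:P :> {poly K} by rewrite subr0.
rewrite monov_XsubC// /mindist /in_Op; case: (eqVneq 0 a) => [<-|a0].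
  by split=> [|[]//]; split=> //; left.
rewrite subr0 le_min; split=> [/andP[-> va]|[[e|->] ->]//]; first by split=> //; right.
by rewrite e eqxx in a0.
Qed.

Lemma X_in_None a : transcendental_over_Q a -> poly_valring (eval_val a) QX_X <-> in_Op v a.
Proof.
move=> ta; rewrite (poly_valring_X (eval_val_val ta)) /eval_val map_polyX hornerX /in_Op.
split; first by right.
case=> // a0; have := transcendental_eval ta (negbT (polyX_eq0 rat)).
by rewrite map_polyX hornerX a0 eqxx.
Qed.

Hypothesis dense : forall (x : K) (n : nat), exists y, algebraic_over_Q y /\ close v n x y.

Lemma valring_of_val : is_valring (fun c : K => vge v 0 c).
Proof.
split; first split.
- by rewrite /vge (fval1 hv) lexx orbT.
- by move=> x y; exact: vgeB.
- by move=> x y hx hy; rewrite -[0]addr0; exact: vgeM.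
move=> x; have [->|x0] := eqVneq x 0; first by left; exact: vge0.
by rewrite !vge_val ?invr_eq0// fvalV// oppr_ge0; apply/orP; exact: le_total.
Qed.

(** Evaluation at [a] sends W into the valuation ring of [K], whose residues are algebraic over F_p
    by density of the algebraic numbers. *)
Lemma res_algebraic_eval a W : transcendental_over_Q a ->
  (forall phi, W phi <-> poly_valring (eval_val a) phi) -> res_algebraic p W.
Proof.
move=> ta hW t /hW[f [g [g0 Et h]]].
have te := transcendental_eval ta.
pose ev (x : QX) (c : K) := exists f g, [/\ g != 0, x = QXof f / QXof g & c = (iP f).[a] / (iP g).[a]].
pose c := (iP f).[a] / (iP g).[a].
have hc : vge v 0 c.
  rewrite /c; case: h => [->|h]; first by rewrite rmorph0 horner0 mul0r vge0.
  have [->|f0] := eqVneq f 0; first by rewrite rmorph0 horner0 mul0r vge0.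
  by rewrite vge_val ?mulf_neq0 ?invr_eq0 ?te// val_div ?te// subr_ge0.
have hid x : (vge v 0 (idfun x) <-> vge v 0 x) by [].
have near0 : dlt (fun c : K => vge v 0 c) (c - idfun c) 1.
  by rewrite subrr; apply: (dlt0 (oner_neq0 _)).
have [P [hP Pc]] := @algebraic_residue p K v iota pp hv K _ idfun valring_of_val hid dense c c hc near0.
exists P; split=> //.
have [F [G [G0 -> EG]]] : ev (map_poly intr P).[t] (map_poly intr P).[c].
  apply: horner_int_rel => [x b y d|x b y d|z|]; last by exists f, g.
  - move=> [f1 [g1 [g10 -> ->]]] [f2 [g2 [g20 -> ->]]].
    exists (f1 * g2 + f2 * g1), (g1 * g2); rewrite mulf_neq0//; split=> //.
      by rewrite addf_div ?QXof_eq0// /QXof tofracD !tofracM.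
    by rewrite addf_div ?te// rmorphD !rmorphM hornerD !hornerM.
  - move=> [f1 [g1 [g10 -> ->]]] [f2 [g2 [g20 -> ->]]].
    exists (f1 * f2), (g1 * g2); rewrite mulf_neq0//; split=> //.
      by rewrite mulf_div /QXof !tofracM.
    by rewrite mulf_div !rmorphM !hornerM.
  - exists (z%:~R), 1; rewrite oner_neq0; split=> //.
      by rewrite /QXof rmorph1 divr1 rmorph_int.
    by rewrite rmorph1 hornerC divr1 rmorph_int -(rmorph_int (@polyC K)) hornerC.
have [F0|F0] := eqVneq F 0.
  by split; [apply/hW; rewrite F0 /QXof rmorph0 mul0r; exact: poly_valring0 | left; rewrite F0 /QXof rmorph0 mul0r].
apply/(maxideal_poly_valring (eval_val_val ta) hW F0 G0).
rewrite /eval_val ltNge; apply/negP => le; case: Pc; rewrite EG.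
have y0 : (iP F).[a] / (iP G).[a] != 0 by rewrite mulf_neq0 ?invr_eq0 ?te.
apply/(dle_div _ _ y0); rewrite div1r invf_div.
by rewrite vge_val ?mulf_neq0 ?invr_eq0 ?te// val_div ?te// subr_ge0.
Qed.

(** No cancellation can occur: the constant term of h - r is -r alone, and the other terms have
    minimum 0. *)
Lemma gaussv_subC (h : {poly K}) d r : h != 0 -> h`_0 = 0 -> gaussv v d h = 0 ->
  gaussv v d (h - r%:P) = mindist v 0 0 r.
Proof.
move=> h0 hh0 gh; rewrite /mindist sub0r fvalN//; case: eqVneq => [->|r0]; first by rewrite subr0.
have c0 : (h - r%:P)`_0 = - r by rewrite coefB hh0 coefC sub0r.
have cS i : (h - r%:P)`_i.+1 = h`_i.+1 by rewrite coefB coefC subr0.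
have aux s : s <= 0 -> vge v s r -> forall i, vge v (s - i%:R * d) (h - r%:P)`_i.
  move=> s0 hs [|i]; first by rewrite c0 mul0r subr0 vgeN.
  by rewrite cS; apply: vge_le (gaussv_vge v d h i.+1); rewrite gh lerD2r.
rewrite /Order.min; case: ifP => [lt|/negbT]; last rewrite -leNgt => le.
  have [[|i] hi vhi] := gaussv_attained v d h0; first by rewrite hh0 eqxx in hi.
  apply: (@gaussv_eq _ _ _ _ _ i.+1); rewrite ?cS ?vhi//.
  by apply: aux => //; rewrite vge_val// ltW.
apply: (@gaussv_eq _ _ _ _ _ 0%N); rewrite ?c0 ?oppr_eq0// ?fvalN// ?mul0r ?addr0//.
by apply: aux => //; exact: vge_refl.
Qed.

(* If [G] vanishes at the center and has value 0, its residue is transcendental: composing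
   with [G] turns the Gauss valuation of [K[T]] into [monov v b d]. *)
Lemma monov_comp (b : K) d (G Q : {poly K}) : G != 0 -> root G b -> monov v b d G = 0 ->
  Q != 0 -> Q \Po G != 0 /\ monov v b d (Q \Po G) = monov v 0 0 Q.
Proof.
move=> G0 rG mG Q0; have [s E _] := factor_poly Q0.
have lin r : monov v b d (G - r%:P) = monov v 0 0 ('X - r%:P).
  rewrite monov_XsubC// monovE comp_polyB comp_polyC; apply: gaussv_subC => //.
    exact: comp_XaddC_neq0.
  by rewrite -horner_coef0 horner_comp !hornerE; exact/eqP.
have sG : (1 < size G)%N by apply: root_size_gt1 rG.
have nz r : G - r%:P != 0.
  apply: contraTneq sG => /eqP; rewrite subr_eq0 => /eqP ->.
  by rewrite -leqNgt size_polyC leq_b1.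
have lc0 : lead_coef Q != 0 by rewrite lead_coef_eq0.
have hvb := monov_val hv b d; have hv0 := monov_val hv 0 0.
rewrite E comp_polyZ rmorph_prod /=.
have -> : \prod_(r <- s) (('X - r%:P) \Po G) = \prod_(r <- s) (G - r%:P).
  by apply: eq_bigr => r _; rewrite comp_polyB comp_polyX comp_polyC.
have P0 : \prod_(r <- s) (G - r%:P) != 0.
  by elim/big_ind: _ => //; [exact: oner_neq0 | exact: mulf_neq0].
have P0' : \prod_(r <- s) ('X - r%:P) != 0 :> {poly K}.
  exact/monic_neq0/monic_prod_XsubC.
split; first by rewrite scaler_eq0 negb_or lc0.
rewrite -!mul_polyC (fvalM hvb) ?polyC_eq0// (fvalM hv0) ?polyC_eq0// !monovC//.
rewrite (val_prod hvb)// (val_prod hv0); last by move=> r; rewrite polyXsubC_eq0.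
by congr (_ + _); apply: eq_bigr.
Qed.

Lemma vp_int_unit (z : int) : ~~ (p%:Z %| z)%Z -> vp p z%:~R = 0.
Proof.
move=> h; rewrite /vp numq_int denq_int /= logn1 subr0 lognE pp.
have -> : (p %| `|z|)%N = false by apply/negbTE; move: h; rewrite /dvdz.
by rewrite andbF.
Qed.

Lemma exists_close_algebraic a (d : rat) : exists2 b, algebraic_over_Q b & vge v d (a - b).
Proof.
have [b [ab h]] := dense a (Num.truncn d).+1; exists b => //.
rewrite /vge subr_eq0; case: h => [->|h]; first by rewrite eqxx.
by rewrite (le_trans _ h) ?orbT// ltW// truncnS_gt.
Qed.

Lemma not_res_algebraic_mval a d W :
  (forall phi, W phi <-> poly_valring (mval a d) phi) -> ~ res_algebraic p W.
Proof.
move=> hW res; have [b [f [f0 rf]] ab] := exists_close_algebraic a d.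
rewrite (map_ratr iota) in rf.
have mE h : h != 0 -> mval a d h = mval b d h.
  by move=> h0; apply: monov_close; rewrite ?map_poly_eq0.
have hb := mval_val b d.
pose m := `|denq (mval b d f)|%N.
have m0 : (0 < m)%N by rewrite absz_gt0 denq_neq0.
have [c c0 vc] := rat_of_val pp hv vi (- numq (mval b d f)).
(* The power [m] clears the denominator of the value of [f], and [c] brings the value to 0; [g]
   still vanishes at the center [b]. *)
pose g := c%:P * f ^+ m.
have g0 : g != 0 by rewrite mulf_neq0 ?polyC_eq0 ?expf_neq0.
have ug : mval b d g = 0.
  rewrite (fvalM hb) ?polyC_eq0 ?expf_neq0// (fvalX hb)// mvalC// -vi// vc.
  rewrite -[m%:R]/(m%:Z%:~R) absz_denq rmorphN /=.
  by rewrite -{3}(divq_num_den (mval b d f)) mulrCA mulfV ?intr_eq0 ?denq_neq0// mulr1 addNr.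
have iPg0 : iP g != 0 by rewrite map_poly_eq0.
have rg : root (iP g) b.
  rewrite /root rmorphM rmorphXn hornerM horner_exp (eqP rf) expr0n.
  by rewrite (negPf (lt0n_neq0 m0)) mulr0.
have Wg : W (QXof g).
  apply/hW; exists g, 1; rewrite oner_neq0 /QXof rmorph1 divr1; split=> //; right.
  by rewrite (mE g g0) ug (fval1 (mval_val a d)).
have [P [[i hi] hP]] := res _ Wg.
pose h := map_poly intr P \Po g.
have Eh : (map_poly intr P).[QXof g] = QXof h / QXof 1.
  by rewrite /QXof rmorph1 divr1; exact: horner_int_morph.
pose Q : {poly K} := map_poly intr P.
have Qi : v Q`_i = 0 /\ Q`_i != 0.
  rewrite coef_map /= -(rmorph_int iota) fmorph_eq0 intr_eq0.
  have Pi : P`_i != 0 by apply: contraNneq hi => ->; rewrite dvdz0.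
  by rewrite vi ?intr_eq0// vp_int_unit.
have Q0 : Q != 0 by case: Qi => _; apply: contraNneq => ->; rewrite coef0.
have Eih : iP h = Q \Po iP g.
  rewrite /h map_comp_poly; congr (_ \Po _); rewrite /Q -map_poly_comp.
  by apply: eq_map_poly => z /=; rewrite rmorph_int.
have [QG0 mQG] := monov_comp iPg0 rg ug Q0.
have h0 : h != 0 by rewrite -(map_poly_eq0 iota) Eih.
move: hP; rewrite Eh => /(maxideal_poly_valring (mval_val a d) hW h0 (oner_neq0 _)).
rewrite (fval1 (mval_val a d)) mE// /mval Eih mQG monovE addr0 comp_polyXr.
(* The coefficient of [P] prime to p has value 0, so the Gauss value of [P], which is the value of
   P(g), is not positive. *)
apply/negP; rewrite -leNgt; apply: le_trans (gaussv_le v 0 Qi.2) _.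
by rewrite Qi.1 mulr0 addr0.
Qed.

End Extensions.

(** * The theorem *)

Section Main.
Variables (p : nat) (K : closedFieldType) (v : K -> rat) (iota : {rmorphism rat -> K}).
Hypotheses (pp : prime p) (hv : is_val v).
Hypothesis vi : forall q, q != 0 -> v (iota q) = vp p q.

Local Notation iP := (map_poly iota).

Lemma QXconst_morphism : exists2 T : {rmorphism rat -> QX}, QXconst =1 T & injective T.
Proof.
exists (@FracField.tofrac {poly rat} \o @polyC rat) => //.
by move=> x y /= /eqP; rewrite tofrac_eq => /eqP/polyC_inj.
Qed.

(** After division by a power of p, a nonzero rational and its inverse both lie in Z_(p), so [nu]
    vanishes on the quotient. *)
Lemma rat_val_proportional (nu : rat -> rat) : is_val nu ->
  (forall q, q != 0 -> (0 <= nu q) = (0 <= vp p q)) ->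
  0 < nu p%:R /\ forall q, q != 0 -> nu q = nu p%:R * vp p q.
Proof.
move=> hnu same; have p0 := rat_prime_neq0 pp.
have hmu : is_val (v \o iota) by exact: is_val_shift (fmorph_inj iota).
have muE q : q != 0 -> vp p q = (v \o iota) q by move=> q0; rewrite /= vi.
split.
  rewrite lt_def same// vp_prime// ler01 andbT; apply/eqP => nup.
  have : 0 <= nu p%:R^-1 by rewrite fvalV// nup oppr0.
  by rewrite same ?invr_eq0// muE ?invr_eq0// (fvalV hmu)// -muE// vp_prime// lerNr oppr0 ler10.
move=> q q0; rewrite /vp; set k := (_ - _).
have vq : (v \o iota) q = k%:~R by rewrite -muE.
pose q' := q / p%:R ^ k.
have pk0 : p%:R ^ k != 0 :> rat by rewrite expfz_neq0.
have q'0 : q' != 0 by rewrite mulf_neq0 ?invr_eq0.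
have mu0 : (v \o iota) q' = 0.
  by rewrite (val_div hmu)// (fval_exprz hmu)// -(muE p%:R)// vp_prime// mulr1 vq subrr.
have nu0 : nu q' = 0.
  apply/eqP; rewrite eq_le -oppr_ge0 -(fvalV hnu)// !same ?invr_eq0// !muE ?invr_eq0//.
  by rewrite (fvalV hmu)// mu0 oppr0 lexx.
by rewrite -(divfK pk0 q) -/q' (fvalM hnu)// nu0 add0r (fval_exprz hnu)// mulrC.
Qed.

Lemma DVR_val W : isDVR W -> lies_over_Zp p W ->
  exists (u : {poly rat} -> rat) (e : nat), [/\ is_val u, forall q, q != 0 -> u q%:P = vp p q,
    (0 < e)%N, forall f, f != 0 -> exists z : int, e%:R * u f = z%:~R &
    forall phi, W phi <-> poly_valring u phi].
Proof.
move=> [w [wM [wD [_ hW]]]] over.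
pose wr x : rat := (w x)%:~R.
have hwr : is_val wr.
  split=> x y x0 y0; first by rewrite /wr (wM _ _ x0 y0) intrD.
  by move=> s0; have := wD _ _ x0 y0 s0; rewrite /wr !ge_min !ler_int.
have [T TE Tinj] := QXconst_morphism.
have hnu : is_val (wr \o T) by exact: is_val_shift Tinj.
have [|nup nuE] := rat_val_proportional hnu.
  move=> q q0; rewrite vp_ge0//=; apply/idP/idP.
    by rewrite /wr ler0z => h; apply/over/hW; right; rewrite TE.
  move=> /over/hW; rewrite TE => -[/eqP|]; first by rewrite fmorph_eq0 (negPf q0).
  by rewrite /wr ler0z.
pose c := (wr \o T) p%:R.
(* The ramification index of W over Z_(p); dividing [w] by it makes the value of p equal to 1. *)
pose e := `|w (T p%:R)|%N.
have ec : e%:R = c.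
  by rewrite /c /= /wr /e -[LHS]/(`|w (T p%:R)|%N%:Z%:~R) gez0_abs// -(ler_int rat) ltW.
have c0 : c != 0 by exact: lt0r_neq0.
have hT : is_val (fun f => wr (QXof f)).
  by apply: (@is_val_shift _ _ hwr _ (@FracField.tofrac {poly rat})) => x y /eqP;
    rewrite tofrac_eq => /eqP.
pose u f := wr (QXof f) / c.
have hu : is_val u.
  split=> f g f0 g0; first by rewrite /u (fvalM hT f0 g0) mulrDl.
  move=> s0; have := hT.2 _ _ f0 g0 s0; rewrite /u !ge_min.
  by rewrite !ler_pM2r ?invr_gt0.
exists u, e; split=> //.
- move=> q q0; rewrite /u -[QXof q%:P]/(QXconst q) TE -[wr (T q)]/((wr \o T) q) nuE//.
  by rewrite mulrAC mulfV ?mul1r.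
- by rewrite -(ltr_nat rat) ec.
- by move=> f _; exists (w (QXof f)); rewrite ec /u mulrCA mulfV ?mulr1.
move=> phi; have [f [g [g0 ->]]] := QX_frac phi.
have [->|f0] := eqVneq f 0.
  by rewrite /QXof rmorph0 mul0r; split=> _; [exact: poly_valring0 | apply/hW; left].
have fg0 : QXof f / QXof g != 0 by rewrite mulf_eq0 invr_eq0 !QXof_eq0 (negPf f0).
rewrite (poly_valring_frac hu f0 g0) hW /u ler_pM2r ?invr_gt0// -subr_ge0.
rewrite -(val_div hwr) ?QXof_eq0// /wr ler0z.
by split=> [[e0|//]|h]; [rewrite e0 eqxx in fg0 | right].
Qed.

Hypothesis complete : forall w : nat -> K,
  (forall n : nat, exists N, forall m k, (N <= m)%N -> (N <= k)%N -> close v n (w m) (w k)) ->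
  exists l, forall n : nat, exists N, forall m, (N <= m)%N -> close v n (w m) l.
Hypothesis dense : forall (x : K) (n : nat), exists y, algebraic_over_Q y /\ close v n x y.

Lemma exists_pair W : isDVR W -> lies_over_Zp p W ->
  exists a d, admissible v a d /\ in_Cpbr v a /\ forall phi, W phi <-> Zpad v a d phi.
Proof.
move=> dvr over; have [u [e [hu uC e0 ue hW]]] := DVR_val dvr over.
have [B [hB BK BQ]] := common_extension pp hv vi hu uC.
have tofrac_inj : injective (@FracField.tofrac {poly K}).
  by move=> x y /eqP; rewrite tofrac_eq => /eqP.
pose T : {rmorphism {poly K} -> {fraction {poly K}}} := @FracField.tofrac {poly K}.
have [res|nres] := pselect (residually_algebraic p iota T B).
  have [a ha] := limit_point pp hv vi hu uC e0 ue tofrac_inj hB BK BQ complete res.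
  have ta : transcendental_over_Q a.
    by apply: (transcendental_of_eval (iota := iota)) => f /ha[].
  exists a, None; split=> //; split.
    apply: (@discrete_in_Cpbr _ _ iota hv); exists e => // h h0.
    have hn0 : h != 0 by apply: contraNneq h0 => ->; rewrite rmorph0 horner0.
    by rewrite (ha h hn0).2; exact: ue.
  move=> phi; rewrite hW (Zpad_None v iota phi ta).
  by split; apply: poly_valring_ext => f f0; rewrite /eval_val (ha f f0).2.
have [b [d [ab mE]]] := algebraic_center pp hv vi hu uC e0 ue tofrac_inj hB BK BQ dense nres.
exists b, (Some d); split; first exact: (algebraic_over_Qp_of_Q v iota).
split; first exact: (discrete_in_Cpbr hv (discrete_at_algebraic hv vi ab)).
move=> phi; rewrite hW (Zpad_Some v iota).
by split; apply: poly_valring_ext => f f0; rewrite /mval mE.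
Qed.

Lemma Zpad_None_DVR a W : transcendental_over_Q a -> in_Cpbr v a ->
  (forall phi, W phi <-> Zpad v a None phi) -> isDVR W /\ lies_over_Zp p W.
Proof.
move=> ta ra hW; have hW' phi : W phi <-> poly_valring (eval_val v iota a) phi.
  by rewrite hW; exact: Zpad_None.
have uC : forall q, q != 0 -> eval_val v iota a q%:P = vp p q by exact: eval_valC.
have hu := eval_val_val iota hv ta.
have [N N0 hN] := in_Cpbr_discrete iota ra.
split; last exact: lies_over_poly_valring pp hu uC hW'.
apply: (isDVR_poly_valring pp hu uC hW' N0) => f f0; apply: hN; exact: transcendental_eval.
Qed.

Lemma Zpad_Some_DVR a d W : (forall phi, W phi <-> Zpad v a (Some d) phi) ->
  isDVR W /\ lies_over_Zp p W.
Proof.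
move=> hW; have hW' phi : W phi <-> poly_valring (mval v iota a d) phi.
  by rewrite hW; exact: Zpad_Some.
have uC : forall q, q != 0 -> mval v iota a d q%:P = vp p q by exact: mvalC.
have hu := mval_val iota hv a d.
split; last exact: lies_over_poly_valring pp hu uC hW'.
(* Discreteness is read off at a center algebraic over Q in the same ball, which defines the same
   valuation. *)
have [b ab close_ab] := exists_close_algebraic dense a d.
have [N N0 hN] := monov_discrete d (discrete_at_algebraic hv vi ab).
apply: (isDVR_poly_valring pp hu uC hW' N0) => f f0; rewrite /mval (monov_close hv close_ab) ?map_poly_eq0//.
exact: hN.
Qed.

Lemma pair_properties a d W : admissible v a d -> (forall phi, W phi <-> Zpad v a d phi) ->
  (W QX_X <-> (in_Op v a /\ match d with Some d => 0 <= d | None => True end)) /\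
  (res_transcendental p W <-> d <> None) /\
  (res_algebraic p W <-> d = None /\ transcendental_over_Q a).
Proof.
case: d => [d|] /= ad hW.
  have hW' phi : W phi <-> poly_valring (mval v iota a d) phi by rewrite hW; exact: Zpad_Some.
  have nres := not_res_algebraic_mval pp hv vi dense hW'.
  split; first by rewrite hW'; exact: X_in_Some.
  by split; split=> // -[].
have hW' phi : W phi <-> poly_valring (eval_val v iota a) phi by rewrite hW; exact: Zpad_None.
have res : res_algebraic p W by exact: res_algebraic_eval hW'.
split; first by rewrite hW' X_in_None//; split=> [|[]].
split; last by split.
by split=> [nres|nn]; [case: (nres res) | case: nn].
Qed.

End Main.

Theorem mainTheorem5 (p : nat) (K : closedFieldType) (v : K -> rat) :
  prime p -> Cp_model p v ->
  (forall W : QX -> Prop, isDVR W -> lies_over_Zp p W ->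
    (* (1) *)
    (exists (a : K) (d : option rat), admissible v a d /\ in_Cpbr v a /\
       forall phi, W phi <-> Zpad v a d phi) /\
    (forall (a : K) (d : option rat), admissible v a d -> in_Cpbr v a ->
       (forall phi, W phi <-> Zpad v a d phi) ->
       (* in this case: *)
       (W QX_X <-> (in_Op v a /\ match d with Some d => 0 <= d | None => True end)) /\
       (* (2) *)
       (res_transcendental p W <-> d <> None) /\
       (res_algebraic p W <-> d = None /\ transcendental_over_Q a))) /\
  (* consequences *)
  (forall W : QX -> Prop,
     (isDVR W /\ lies_over_Zp p W /\ res_algebraic p W) <->
     exists a : K, in_Cpbr v a /\ transcendental_over_Q a /\
       forall phi, W phi <-> Zpad v a None phi) /\
  (forall W : QX -> Prop,
     (isDVR W /\ lies_over_Zp p W /\ res_transcendental p W) <->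
     exists (a : K) (d : rat), algebraic_over_Qp v a /\
       forall phi, W phi <-> Zpad v a (Some d) phi).
Proof.
move=> pp HK; have hv := Cp_model_val HK; have [iota vi] := Cp_model_iota HK.
have complete := Cp_complete HK; have dense := Cp_dense HK.
have pair := exists_pair pp hv vi complete dense.
have props := pair_properties pp hv vi dense.
split=> [W dvr over|]; first by split=> [|a d ad _]; [exact: pair | exact: props].
split=> W; split.
- move=> [dvr [over res]]; have [a [d [ad [ra hW]]]] := pair W dvr over.
  have [_ [_ [/(_ res)[d0 ta] _]]] := props a d W ad hW.
  by exists a; rewrite d0 in hW.
- move=> [a [ra [ta hW]]]; have [dvr over] := Zpad_None_DVR pp hv vi ta ra hW.
  by have [_ [_ res]] := props a None W ta hW; split=> //; split=> //; apply/res.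
- move=> [dvr [over res]]; have [a [d [ad [ra hW]]]] := pair W dvr over.
  have [_ [[/(_ res) d0 _] _]] := props a d W ad hW.
  by case: d ad hW d0 => // d ad hW _; exists a, d.
- move=> [a [d [aa hW]]]; have [dvr over] := Zpad_Some_DVR pp hv vi dense hW.
  by have [_ [res _]] := props a (Some d) W aa hW; split=> //; split=> //; apply/res.
Qed.
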